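(* Consider a network of $N\ge 2$ reinforced stochastic processes with irreducible interaction matrix $W$ and sequence $(r_n)_{n\ge 0}$, $0\le r_n<1$, as defined in the context, and assume $P(T_0)<1$, where $T_0=\{\boldsymbol{Z}_0=\boldsymbol{0}\}\cup\{\boldsymbol{Z}_0=\boldsymbol{1}\}$. Assume that at least one of the following holds: (1) $\sum_n r_n=+\infty$ and $W$ is aperiodic; (2) $\sum_n r_n(1-r_n)=+\infty$. Let $Z_\infty$ be the common almost sure limit of the processes $(Z_{n,l})_n$, $l\in V$, and let $T_\infty=\{Z_\infty=0\}\cup\{Z_\infty=1\}$. If moreover $$r_n=O\Big(e^{-\sum_{k=0}^n r_k}\sum_{k=0}^n r_k\Big)\quad (n\to\infty)$$ or, equivalently, $$\frac{r_n}{\sum_{k=0}^n r_k}=O\Big(\prod_{k=0}^n(1-r_k)\Big)\quad (n\to\infty),$$ then $P(T_\infty\mid T_0^c)=0$. In particular, these conditions are satisfied when there exists $0<c\le 1$ such that $\lim_n n r_n=c$ and the series $\sum_{n\ge 1}(r_n-cn^{-1})$ is convergent.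
   Context: Network of reinforced stochastic processes: $V=\{1,\dots,N\}$, $N\ge 2$; $W=[w_{l_1,l_2}]_{l_1,l_2\in V}$ is a deterministic matrix with entries $w_{l_1,l_2}\ge 0$ and $\sum_{l_1=1}^N w_{l_1,l_2}=1$ for each $l_2\in V$ (i.e. $W^\top\boldsymbol{1}=\boldsymbol{1}$). $\{Z_{0,l}:l\in V\}$ are random variables with values in $[0,1]$; for each $n\ge 1$, $\{X_{n,l}:l\in V\}$ are random variables with values in $\{0,1\}$. Put $\mathcal{F}_n=\sigma(Z_{0,l}:l\in V)\vee\sigma(X_{k,l}:1\le k\le n,\ l\in V)$. For each $n\ge 0$, the variables $\{X_{n+1,l}:l\in V\}$ are conditionally independent given $\mathcal{F}_n$ with $P(X_{n+1,l}=1\mid\mathcal{F}_n)=\sum_{l_1=1}^N w_{l_1,l}Z_{n,l_1}$ a.s., and $Z_{n+1,l}=(1-r_n)Z_{n,l}+r_nX_{n+1,l}$ for each $l\in V$, where $(r_n)_{n\ge 0}$ is a deterministic sequence with $0\le r_n<1$. Notation: $\boldsymbol{Z}_n=(Z_{n,1},\dots,Z_{n,N})^\top$; $\boldsymbol{0}$ and $\boldsymbol{1}$ are the vectors with all entries $0$, respectively $1$. Periodicity: the period of $l\in V$ is the greatest common divisor of the integers $n\ge 1$ with $(W^n)_{l,l}>0$; if $W$ is irreducible all periods coincide, and $W$ is aperiodic if this common period is $1$. Known fact (complete almost sure asymptotic synchronization): when $W$ is irreducible and (1) or (2) holds, all the processes $(Z_{n,l})_n$, $l\in V$, converge almost surely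 to one and the same random variable $Z_\infty$. *)

(* Defs.v *)
From HB Require Import structures.
From mathcomp Require Import all_boot all_order all_algebra.
From mathcomp Require Import all_classical all_reals all_analysis.
Set Implicit Arguments.
Unset Strict Implicit.
Unset Printing Implicit Defensive.
Import Order.TTheory GRing.Theory Num.Theory.
Import numFieldNormedType.Exports.
Local Open Scope classical_set_scope.
Local Open Scope ring_scope.

Section InteractionMatrix.
Context {R : realType} {N : nat}.
Implicit Type W : 'M[R]_N.

(* Columns, not rows, sum to 1. *)
Definition column_stochastic W :=
  (forall l1 l2, 0 <= W l1 l2) /\ (forall l2, \sum_l1 W l1 l2 = 1).

Definition irreducible_mx W :=
  forall l1 l2, exists2 n : nat, (0 < n)%N & 0 < (W ^+ n) l1 l2.

Definition return_times W (l : 'I_N) : set nat :=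
  [set n : nat | (0 < n)%N /\ 0 < (W ^+ n) l l].

(* The greatest common divisor of a possibly infinite set of integers,
   characterized as the common divisor that all common divisors divide. *)
Definition is_gcd (A : set nat) (p : nat) :=
  (forall n, A n -> (p %| n)%N) /\
  (forall q : nat, (forall n, A n -> (q %| n)%N) -> (q %| p)%N).

Definition is_period W l (p : nat) := is_gcd (return_times W l) p.

Definition aperiodic_mx W := forall l, is_period W l 1.

End InteractionMatrix.

Section Conditioning.
Context {R : realType} {d : measure_display} {Omega : measurableType d}
  (P : probability Omega R).

(* [G] is a sub-sigma-algebra given as a set of events. [is_cond_prob G A g]
   says that [g] is a version of P(A | G). *)
Definition is_cond_prob (G : set (set Omega)) (A : set Omega)
    (g : Omega -> R) :=
  [/\ forall B : set R, measurable B -> G (g @^-1` B),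
      P.-integrable setT (EFin \o g) &
      forall B, G B -> (\int[P]_(w in B) (g w)%:E = P (A `&` B))%E].

(* P(X_i \in B_i for all i | G) = \prod_i P(X_i \in B_i | G) a.s. for all Borel
   sets B_i; the sub-families are covered by B_i = R. *)
Definition cond_independent (G : set (set Omega)) (I : finType)
    (X : I -> {RV P >-> R}) :=
  forall (B : I -> set R) (g : I -> Omega -> R),
    (forall i, measurable (B i)) ->
    (forall i, is_cond_prob G (X i @^-1` B i) (g i)) ->
    is_cond_prob G [set w | forall i, B i (X i w)] (fun w => \prod_i g i w).

(* P(A | B) for an event B of positive probability. *)
Definition cond_prob_event (A B : set Omega) : R :=
  fine (P (A `&` B)) / fine (P B).

End Conditioning.

Section Network.
Context {R : realType} {d : measure_display} {Omega : measurableType d}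
  {P : probability Omega R} {N : nat}.
Implicit Types (W : 'M[R]_N) (r : nat -> R) (X Z : nat -> 'I_N -> {RV P >-> R}).

(* The sigma-algebra F_n generated by Z_0 and X_1, ..., X_n. *)
Definition network_filtration X Z (n : nat) : set (set Omega) :=
  <<s (\bigcup_l g_sigma_algebra_preimage (Z 0%N l)) `|`
      (\bigcup_(k in [set k : nat | (1 <= k <= n)%N])
         \bigcup_l g_sigma_algebra_preimage (X k l)) >>.

(* [X n] is meaningful for n >= 1 only: nothing refers to [X 0]. *)
Record is_reinforced_network W r X Z : Prop := {
  network_W : column_stochastic W;
  network_Z0 : forall l w, 0 <= Z 0%N l w <= 1;
  network_X01 : forall n l w, X n.+1 l w = 0 \/ X n.+1 l w = 1;
  network_cond_indep : forall n,
    cond_independent (network_filtration X Z n) (X n.+1);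
  network_cond_prob : forall n l,
    is_cond_prob P (network_filtration X Z n) (X n.+1 l @^-1` [set 1])
      (fun w => \sum_l1 W l1 l * Z n l1 w);
  network_step : forall n l w,
    Z n.+1 l w = (1 - r n) * Z n l w + r n * X n.+1 l w }.

Definition T0 Z : set Omega :=
  [set w | forall l, Z 0%N l w = 0] `|` [set w | forall l, Z 0%N l w = 1].

Definition Tinf (Zinf : {RV P >-> R}) : set Omega :=
  [set w | Zinf w = 0] `|` [set w | Zinf w = 1].

Definition is_common_as_limit Z (Zinf : {RV P >-> R}) :=
  forall l, {ae P, forall w, Z n l w @[n --> \oo] --> Zinf w}.

Definition sync_condition W r :=
  ((\sum_(n <oo) (r n)%:E = +oo)%E /\ aperiodic_mx W) \/
  (\sum_(n <oo) (r n * (1 - r n))%:E = +oo)%E.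

End Network.

Section RateConditions.
Context {R : realType}.
Implicit Type r : nat -> R.

Definition rate_exp r :=
  r =O_\oo (fun n => expR (- \sum_(k < n.+1) r k) * \sum_(k < n.+1) r k).

(* The quotient is 0 for the initial n, if any, with r_0 = ... = r_n = 0. *)
Definition rate_prod r :=
  (fun n => r n / \sum_(k < n.+1) r k) =O_\oo
  (fun n => \prod_(k < n.+1) (1 - r k)).

End RateConditions.

(* Main.v *)
Require Import Defs.
From mathcomp Require Import all_boot all_order all_algebra.
From mathcomp Require Import all_classical all_reals all_analysis.
From mathcomp Require Import measurable_realfun ring lra.
Import Order.TTheory GRing.Theory Num.Theory.
Import numFieldNormedType.Exports.
Local Open Scope classical_set_scope.
Local Open Scope ring_scope.

(** Let [v] be the Perron vector of [W].  Then [M = v . Z] is a martingale with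
    [M_(n+1) = (1 - r_n) M_n + r_n D_(n+1)], where [D] takes values in [0, 1] and
    has conditional mean [M_n], so by the symmetry [Z -> 1 - Z] it is enough
    to exclude [M_n -> 0] when [M_0 > 0].  Put [S_n = r_0 + ... + r_(n-1)] and
    [p_n = (1 - r_0) ... (1 - r_(n-1))].  The ratio [Y = M / p] is nondecreasing
    and, by the rate condition, its jumps are at most [C S].

    If [M_n >= K S_n p_n], an exponential supermartingale bounds the conditional
    probability of [M -> 0] by [exp (- c K)], because the rate condition gives
    [\sum_(k >= n) r_k ^ 2 = O(S_n p_n)].  On the other hand [Y < K S] cannot
    persist: as long as it holds, [ln (1 + Y) <= ln S + O(1)], whereas the
    conditional increments of [ln (1 + Y)] are at least a multiple of
    [r ln (S) / S], whose sum is of order [ln (S) ^ 2]. *)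

(** * Consequences of the rate condition *)

Section Rates.
Context {R : realType} (r : nat -> R).
Hypothesis r01 : forall n, 0 <= r n < 1.

Definition rsum n : R := \sum_(k < n) r k.
Definition cprod n : R := \prod_(k < n) (1 - r k).

Lemma rsumS n : rsum n.+1 = rsum n + r n.
Proof. by rewrite /rsum big_ord_recr. Qed.

Lemma cprodS n : cprod n.+1 = cprod n * (1 - r n).
Proof. by rewrite /cprod big_ord_recr. Qed.

Lemma cprod_gt0 n : 0 < cprod n.
Proof. by apply: prodr_gt0 => k _; case/andP: (r01 k); rewrite subr_gt0. Qed.

Lemma cprod_ge0 n : 0 <= cprod n.
Proof. exact/ltW/cprod_gt0. Qed.

Lemma rsum_ge0 n : 0 <= rsum n.
Proof. by apply: sumr_ge0 => k _; case/andP: (r01 k). Qed.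

Lemma le_rsum m n : (m <= n)%N -> rsum m <= rsum n.
Proof.
move=> /subnK <-; elim: (n - m)%N => [//|k IH].
by rewrite addSn rsumS (le_trans IH)// lerDl; case/andP: (r01 (k + m)).
Qed.

Lemma r_le_rsum n : r n <= rsum n.+1.
Proof. by rewrite rsumS lerDr rsum_ge0. Qed.

Lemma cprod_le_exp n : cprod n <= expR (- rsum n).
Proof.
elim: n => [|n IH]; first by rewrite /cprod /rsum !big_ord0 oppr0 expR0.
rewrite cprodS rsumS opprD expRD ler_pM ?cprod_ge0//.
- by case/andP: (r01 n) => _ /ltW; rewrite subr_ge0.
- exact: expR_ge1Dx.
Qed.

Lemma rate_expP : rate_exp r <->
  exists (C : R) m, 0 < C /\ forall n, (m <= n)%N ->
    r n <= C * (expR (- rsum n.+1) * rsum n.+1).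
Proof.
have nn n : `|expR (- rsum n.+1) * rsum n.+1| = expR (- rsum n.+1) * rsum n.+1.
  by rewrite ger0_norm// mulr_ge0 ?expR_ge0 ?rsum_ge0.
have nr n : `|r n| = r n by rewrite ger0_norm//; case/andP: (r01 n).
rewrite /rate_exp; split=> [/eqO_exP [C C0 [m _ H]]|[C [m [C0 H]]]].
  by exists C, m; split=> // n mn; rewrite -nn -{1}nr; exact: H.
apply/eqO_exP; exists C => //; exists m => // n /= mn.
by rewrite nn nr; exact: H.
Qed.

Lemma rate_prodP : rate_prod r <->
  exists (C : R) m, 0 < C /\ forall n, (m <= n)%N ->
    r n <= C * (cprod n.+1 * rsum n.+1).
Proof.
have np n : `|cprod n| = cprod n by rewrite gtr0_norm// cprod_gt0.
have r0 n : 0 <= r n by case/andP: (r01 n).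
have nq n : `|r n / rsum n.+1| = r n / rsum n.+1.
  by rewrite ger0_norm// divr_ge0 ?rsum_ge0.
rewrite /rate_prod; split=> [/eqO_exP [C C0 [m _ H]]|[C [m [C0 H]]]].
  exists C, m; split=> // n mn; have := H n mn.
  rewrite /= -/(cprod n.+1) -/(rsum n.+1) nq np mulrA.
  (* If [rsum n.+1] vanishes, the quotient is 0 by convention and carries no information, but
     [r n <= rsum n.+1] then forces [r n] to be 0. *)
  have [s0|s0] := ltrP 0 (rsum n.+1); first by rewrite ler_pdivrMr.
  move=> _; rewrite (le_trans (r_le_rsum n))// (le_trans s0)//.
  by rewrite !mulr_ge0 ?rsum_ge0 ?(ltW C0) ?cprod_ge0.
apply/eqO_exP; exists C => //; exists m => // n /= mn.
rewrite -/(cprod n.+1) -/(rsum n.+1) nq np.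
have [s0|s0] := ltrP 0 (rsum n.+1).
  by rewrite ler_pdivrMr// -mulrA; exact: H.
have -> : r n = 0 by apply/le_anti; rewrite r0 andbT (le_trans (r_le_rsum n)).
by rewrite mul0r mulr_ge0 ?(ltW C0) ?cprod_ge0.
Qed.

(* [(t + 2) * exp (- t)] is a primitive of [- (t + 1) * exp (- t)]. *)
Let tail_fun (t : R) := (t + 2) * expR (- t).

Let tail_fun_step (s x : R) : 0 <= s -> 0 <= x <= 1 ->
  x * ((s + x) * expR (- (s + x))) <= 2 * (tail_fun s - tail_fun (s + x)).
Proof.
move=> s0 /andP[x0 x1]; rewrite /tail_fun.
have -> : expR (- s) = expR (- (s + x)) * expR x by rewrite -expRD; congr expR; ring.
have E0 := expR_ge0 (- (s + x)); have E1 := expR_ge1Dx x.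
have : (s + 2) * (1 + x) * expR (- (s + x)) <= (s + 2) * (expR (- (s + x)) * expR x).
  by rewrite -mulrA ler_wpM2l ?addr_ge0// mulrC ler_wpM2l.
move: (expR (- (s + x))) (expR x) E0 E1 => E F E0 E1 H.
(* With [exp x >= 1 + x] the drop of [tail_fun] is at least [E * x * (s + 1)]. Twice this exceeds
   [x * (s + x) * E] by exactly this product. *)
have : 0 <= E * x * (s + 2 - x) by rewrite !mulr_ge0//; lra.
move: H; lra.
Qed.

(** One factor of each square is bounded by the rate condition. What remains is a Riemann sum of
    [t * exp (- t)] along the partition [rsum], which [tail_fun] dominates by a telescoping sum. *)
Lemma sum_sqr_tail (C : R) (m : nat) : 0 < C ->
  (forall n, (m <= n)%N -> r n <= C * (expR (- rsum n.+1) * rsum n.+1)) ->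
  forall n j, (m <= n)%N ->
    \sum_(i < j) r (n + i)%N ^+ 2 <= 2 * C * ((rsum n + 2) * expR (- rsum n)).
Proof.
move=> C0 H n j mn.
suff : \sum_(i < j) r (n + i)%N ^+ 2 <=
    2 * C * (tail_fun (rsum n) - tail_fun (rsum (n + j))).
  move/le_trans; apply; rewrite ler_wpM2l ?mulr_ge0 ?(ltW C0)//.
  by rewrite gerBl mulr_ge0 ?expR_ge0 ?addr_ge0 ?rsum_ge0.
elim: j => [|j IH]; first by rewrite big_ord0 addn0 subrr mulr0.
rewrite big_ord_recr/= addnS rsumS.
have r0 := andP (r01 (n + j)); case: r0 => r0 r1.
have st : 0 <= r (n + j)%N <= 1 by rewrite r0 ltW.
have := tail_fun_step _ _ (rsum_ge0 (n + j)) st; rewrite -rsumS => st1.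
have h1 := H (n + j)%N (leq_trans mn (leq_addr _ _)).
have h2 : r (n + j)%N ^+ 2 <=
    C * (2 * (tail_fun (rsum (n + j)) - tail_fun (rsum (n + j).+1))).
  rewrite expr2; apply: le_trans (_ : _ <= r (n + j)%N *
    (C * (expR (- rsum (n + j).+1) * rsum (n + j).+1))) _.
    by rewrite ler_wpM2l.
  by rewrite mulrCA ler_wpM2l ?(ltW C0)// [X in _ * X]mulrC.
by move: IH h2; lra.
Qed.

(** A converse, up to a constant, of [cprod_le_exp]: for [0 <= x <= 1 / 2] one has
    [exp (- x) <= exp (2 * x ^ 2) * (1 - x)], and the product of the correction factors is bounded
    when the squares are summable. *)
Lemma sum_sqr_bounded_exp_le_cprod (B : R) :
  (forall j, \sum_(i < j) r i ^+ 2 <= B) ->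
  exists (C : R) m, 0 < C /\ forall n, (m <= n)%N -> expR (- rsum n) <= C * cprod n.
Proof.
move=> HB.
have cv : cvgn (series (fun i => r i ^+ 2)).
  apply: nondecreasing_is_cvgn.
    by apply/nondecreasing_seqP => n; rewrite !seriesEord/= big_ord_recr/= lerDl sqr_ge0.
  by exists B => _ [n _ <-]; rewrite seriesEord; exact: HB.
(* From [m] on, [r n < 1 / 2], as the one-step comparison requires. *)
have [m _ Hm] : \forall n \near \oo, r n ^+ 2 < 1 / 4.
  have q : (0 : R) < 1 / 4 by lra.
  move/cvg_series_cvg_0 : cv => /cvgrPdist_lt /(_ _ q).
  by apply: filterS => n; rewrite sub0r normrN ger0_norm ?sqr_ge0.
exists (expR (- rsum m) / cprod m * expR (2 * B)), m.
split; first by rewrite !mulr_gt0 ?invr_gt0 ?expR_gt0 ?cprod_gt0.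
suff H n : (m <= n)%N -> expR (- rsum n) <=
    expR (- rsum m) / cprod m * expR (2 * \sum_(m <= i < n) r i ^+ 2) * cprod n.
  move=> n mn; apply: le_trans (H _ mn) _.
  rewrite ler_wpM2r ?cprod_ge0// ler_wpM2l//.
    by rewrite divr_ge0 ?expR_ge0// cprod_ge0.
  rewrite ler_expR ler_wpM2l//; apply: le_trans (HB n).
  rewrite -(big_mkord xpredT (fun i => r i ^+ 2)) [leRHS](big_cat_nat (leq0n m) mn)//=.
  by rewrite lerDr sumr_ge0// => i _; exact: sqr_ge0.
move=> /subnKC <-; elim: (n - m)%N => [|j IH].
  rewrite addn0 big_geq// mulr0 expR0 mulr1 divfK// gt_eqF ?cprod_gt0//.
rewrite addnS rsumS cprodS big_nat_recr ?leq_addr//= opprD expRD.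
rewrite mulrDr expRD.
rewrite [leRHS](_ : _ = expR (- rsum m) / cprod m *
    expR (2 * \sum_(m <= i < m + j) r i ^+ 2) * cprod (m + j) *
    (expR (2 * r (m + j)%N ^+ 2) * (1 - r (m + j)%N))); last by ring.
rewrite ler_pM ?expR_ge0//.
have /andP[r0 r1] := r01 (m + j).
have h4 : r (m + j)%N ^+ 2 < 1/4 by apply: Hm => /=; rewrite leq_addr.
have rh : r (m + j)%N < 1 / 2 by nra.
move: (r (m + j)%N) r0 r1 rh => x x0 x1 xh.
(* The claim follows from [(1 + x + 2 * x ^ 2) * (1 - x) = 1 + x ^ 2 * (1 - 2 * x) >= 1]. *)
have : 1 + (x + 2 * x ^+ 2) <= expR (x + 2 * x ^+ 2) by exact: expR_ge1Dx.
move=> e; rewrite expRN -[leLHS]mul1r ler_pdivrMr ?expR_gt0// mulrAC -expRD.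
have : (1 + (x + 2 * x ^+ 2)) * (1 - x) <= expR (x + 2 * x ^+ 2) * (1 - x).
  by rewrite ler_wpM2r// subr_ge0 ltW.
rewrite [2 * _ + x]addrC; apply: le_trans; nra.
Qed.

Lemma rate_exp_cprod : rate_exp r ->
  exists (C : R) m, 0 < C /\ forall n, (m <= n)%N -> expR (- rsum n) <= C * cprod n.
Proof.
move=> /rate_expP [C [m [C0 H]]].
pose B := \sum_(i < m) r i ^+ 2 + 2 * C * ((rsum m + 2) * expR (- rsum m)).
apply: (@sum_sqr_bounded_exp_le_cprod B) => j.
apply: le_trans (_ : _ <= \sum_(i < m + j) r i ^+ 2) _.
  rewrite addnC big_split_ord/= lerDl sumr_ge0// => i _; exact: sqr_ge0.
by rewrite big_split_ord/= lerD2l (@sum_sqr_tail C m).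
Qed.

(** From right to left [cprod_le_exp] suffices. From left to right the exponential rate first yields
    summable squares, hence the reverse comparison [rate_exp_cprod]. *)
Lemma rate_exp_prod : rate_exp r <-> rate_prod r.
Proof.
split=> [re|/rate_prodP [C [m [C0 H]]]].
  have [C [m [C0 H]]] := rate_exp_cprod re.
  move/rate_expP : re => [C' [m' [C'0 H']]].
  apply/rate_prodP; exists (C' * C), (maxn m m'); split; first exact: mulr_gt0.
  move=> n; rewrite geq_max => /andP[mn m'n].
  apply: le_trans (H' _ m'n) _; rewrite -mulrA ler_wpM2l ?(ltW C'0)// mulrA.
  by rewrite ler_wpM2r ?rsum_ge0// H// ltnW.
apply/rate_expP; exists C, m; split=> // n mn; apply: le_trans (H _ mn) _.
by rewrite ler_wpM2l ?(ltW C0)// ler_wpM2r ?rsum_ge0 ?cprod_le_exp.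
Qed.

End Rates.

(** * Elementary inequalities for the exponential and the logarithm *)

Section Chords.
Context {R : realType}.

Lemma expR_chord (x u : R) : 0 <= x <= 1 -> expR (x * u) <= 1 - x + x * expR u.
Proof.
move=> x01; have /andP[x0 x1] := x01.
have H := convex_expR (Itv01 x0 x1) u 0.
have := H; rewrite !convRE/= expR0 !mulr0 !mulr1 addr0 addrC.
by [].
Qed.

(** This is [expR_chord] at [u = ln (1 + a)], after exponentiation. *)
Lemma ln_chord (x a : R) : 0 <= x <= 1 -> 0 <= a ->
  x * ln (1 + a) <= ln (1 + x * a).
Proof.
move=> x01 a0; have /andP[x0 _] := x01.
rewrite -ler_expR lnK ?posrE ?ltr_pwDl ?mulr_ge0//.
apply: le_trans (expR_chord _ _ x01) _; rewrite lnK ?posrE ?ltr_pwDl//.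
by lra.
Qed.

Lemma expRN_le_quad (x : R) : 0 <= x -> expR (- x) <= 1 - x + x ^+ 2.
Proof.
move=> x0; rewrite expRN -[leLHS]mul1r ler_pdivrMr ?expR_gt0//.
have p : 0 <= 1 - x + x ^+ 2 by nra.
(* The product equals [1 + x ^ 3]. *)
apply: le_trans (_ : _ <= (1 - x + x ^+ 2) * (1 + x)) _; first by nra.
by rewrite ler_wpM2l ?expR_ge1Dx.
Qed.

End Chords.

(** * Growth of logarithmic sums, and the nearly harmonic case *)

Section Growth.
Context {R : realType} (r : nat -> R).
Hypothesis r01 : forall n, 0 <= r n < 1.

(* [ln (1 + C t) ^+ 2] has derivative about [2 ln (1 + C t) / t]. *)
Lemma sum_ln_rsum_ge (C : R) (m n : nat) : 0 < C -> 1 <= rsum r m -> (m <= n)%N ->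
  ln (1 + C * rsum r n) ^+ 2 - ln (1 + C * rsum r m) ^+ 2 <=
  4 * \sum_(m <= k < n) (r k * (ln (1 + C * rsum r k.+1) / rsum r k.+1)).
Proof.
move=> C0 sm /subnKC <-; elim: (n - m)%N => [|j IH].
  by rewrite addn0 big_geq// subrr mulr0.
rewrite addnS big_nat_recr ?leq_addr//= mulrDr.
have s1 : 1 <= rsum r (m + j) by apply: le_trans sm (le_rsum r r01 _ _ (leq_addr _ _)).
have /andP[x0 x1] := r01 (m + j).
suff : ln (1 + C * rsum r (m + j).+1) ^+ 2 - ln (1 + C * rsum r (m + j)) ^+ 2 <=
    4 * (r (m + j)%N * (ln (1 + C * rsum r (m + j).+1) / rsum r (m + j).+1)).
  by move: IH; lra.
rewrite rsumS; move: (rsum r (m + j)) (r (m + j)%N) s1 x0 x1 => s x s1 x0 x1.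
have s'0 : 0 < s + x by lra.
have p1 : 0 < 1 + C * s by rewrite ltr_pwDl// mulr_ge0 ?(ltW C0)//; lra.
have p2 : 0 < 1 + C * (s + x) by rewrite ltr_pwDl// mulr_ge0 ?(ltW C0)//; lra.
have l1 : 0 <= ln (1 + C * s) by rewrite ln_ge0// lerDl mulr_ge0 ?(ltW C0)//; lra.
have l12 : ln (1 + C * s) <= ln (1 + C * (s + x)).
  by rewrite ler_ln ?posrE// lerD2l ler_wpM2l ?(ltW C0)//; lra.
(* The factor 2 absorbs the passage from [s] to [s + x] in the denominator, since [x < 1 <= s]. *)
have d : ln (1 + C * (s + x)) - ln (1 + C * s) <= 2 * (x / (s + x)).
  rewrite -ln_div ?posrE//.
  have -> : (1 + C * (s + x)) / (1 + C * s) = 1 + C * x / (1 + C * s).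
    by field; rewrite gt_eqF.
  apply: le_trans (le_ln1Dx _) _.
    by rewrite (lt_le_trans (ltrN10 _))// divr_ge0 ?mulr_ge0 ?(ltW C0) ?(ltW p1).
  rewrite mulrA ler_pdivrMr// mulrAC ler_pdivlMr//.
  rewrite -subr_ge0.
  have -> : 2 * x * (1 + C * s) - C * x * (s + x) = x * (2 + C * (s - x)) by ring.
  by rewrite mulr_ge0// addr_ge0// mulr_ge0 ?(ltW C0)//; lra.
have -> : x * (ln (1 + C * (s + x)) / (s + x)) = ln (1 + C * (s + x)) * (x / (s + x)).
  by ring.
have q0 : 0 <= x / (s + x) by rewrite divr_ge0 ?(ltW s'0).
move: (ln (1 + C * s)) (ln (1 + C * (s + x))) (x / (s + x)) l1 l12 d q0 => a b q.
(* Here [b ^ 2 - a ^ 2 = (b - a) * (b + a) <= 2 * q * (2 * b)], which explains the constant 4. *)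
nra.
Qed.

Let harm n : R := \sum_(1 <= k < n) k%:R^-1.

(** As [harm] excludes its upper index, this is the exponentiated form of [H_k <= 1 + ln k] at
    [k = n + 1]. *)
Let exp_harm n : expR (harm n.+2) <= expR 1 * n.+1%:R.
Proof.
elim: n => [|n IH]; first by rewrite /harm big_nat1 invr1 mulr1.
rewrite /harm big_nat_recr//= -/(harm n.+2) expRD.
apply: le_trans (ler_wpM2r (expR_ge0 _) IH) _.
rewrite -mulrA ler_wpM2l ?expR_ge0//.
have e : 1 - (n.+2%:R : R)^-1 <= expR (- n.+2%:R^-1) by exact: expR_ge1Dx.
rewrite -ler_pdivlMr ?expR_gt0// -expRN.
apply: le_trans (ler_wpM2l _ e) => //.
rewrite mulrBr mulr1 divff//.
by rewrite -[n.+2%:R]natr1 addrK.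
Qed.

(** The first hypothesis gives [r n = O(1 / n)]. Since [c <= 1], the second gives
    [rsum r n.+1 <= ln n + O(1)], so [exp (- rsum r n.+1)] is at least a multiple of [1 / n], while
    [rsum] stays away from 0. *)
Lemma rate_exp_near_harmonic (c : R) : 0 < c <= 1 ->
  n%:R * r n @[n --> \oo] --> c ->
  cvgn (fun m => \sum_(1 <= n < m) (r n - c * n%:R^-1)) -> rate_exp r.
Proof.
move=> /andP[c0 c1] nr /cvg_seq_bounded [B0 [_ HB0]].
have [B [B0' HB]] : exists B : R, 0 <= B /\ forall m, \sum_(1 <= n < m) (r n - c * n%:R^-1) <= B.
  exists `|B0 + 1|; split => // m; apply: le_trans (ler_norm _) _.
  by apply: le_trans (HB0 (B0 + 1) _ m I) (ler_norm _); rewrite ltrDl.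
have c20 : 0 < c / 2 by lra.
have /cvgrPdist_lt /(_ _ c20) [m _ Hm] := nr.
(* At index 0 the quantity [n * r n] says nothing about [r n], so [m1] must be positive. *)
pose m1 := maxn m 1.
have rm1 : 0 < r m1.
  have /= := Hm m1 (leq_maxl _ _); rewrite ltr_distl => /andP[h1 h2].
  have : 0 < m1%:R * r m1 by lra.
  by rewrite pmulr_rgt0// ltr0n leq_max orbT.
apply/rate_expP => //.
(* The 2 bounds [n * r n], [expR (2 + B)] comes from the lower bound [E] on [exp (- rsum r n.+1)],
   and [r m1] bounds [rsum r n.+1] from below. *)
exists (2 * expR (2 + B) / r m1), m1; split.
  by rewrite !mulr_gt0 ?invr_gt0 ?expR_gt0.
move=> n m1n; have n0 : (0 < n)%N by apply: leq_trans m1n; rewrite leq_max orbT.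
have nR0 : (0 : R) < n%:R by rewrite ltr0n.
have sn : r m1 <= rsum r n.+1.
  by apply: le_trans (r_le_rsum r r01 m1) _; exact: le_rsum.
have rn : r n <= 2 / n%:R.
  have := Hm n (leq_trans (leq_maxl _ _) m1n); rewrite /= ltr_distl => /andP[h1 h2].
  by rewrite ler_pdivlMr//; lra.
have su : rsum r n.+1 <= 1 + B + harm n.+1.
  rewrite /rsum -(big_mkord xpredT r) big_ltn//= -addrA.
  rewrite lerD//; first by case/andP: (r01 0%N) => _ /ltW.
  have := HB n.+1; rewrite sumrB -mulr_sumr -/(harm n.+1).
  have : c * harm n.+1 <= harm n.+1.
    by rewrite ler_piMl// /harm sumr_ge0// => i _; rewrite invr_ge0.
  by lra.
have E : expR (- (2 + B)) / n%:R <= expR (- rsum r n.+1).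
  apply: le_trans (_ : _ <= expR (- (1 + B + harm n.+1))) _; last first.
    by rewrite ler_expR lerN2.
  rewrite ler_pdivrMr// -[leRHS]mulrC -ler_pdivrMl//.
  case: n n0 {m1n nR0 sn rn su} => // n _.
  have -> : - (2 + B) = - (1 + B + harm n.+2) + (harm n.+2 - 1) by ring.
  rewrite expRD mulrCA ger_pMr ?expR_gt0// mulrC ler_pdivrMr ?ltr0n// mul1r.
  by rewrite expRB ler_pdivrMr ?expR_gt0// mulrC exp_harm.
apply: le_trans rn _.
have -> : 2 / n%:R = 2 * expR (2 + B) * (expR (- (2 + B)) / n%:R).
  by rewrite expRN; field; rewrite !gt_eqF ?expR_gt0.
rewrite -2!mulrA [leRHS](_ : _ = 2 * (expR (2 + B) *
  (expR (- rsum r n.+1) * (rsum r n.+1 / r m1)))); last by ring.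
rewrite ler_wpM2l// ler_wpM2l ?expR_ge0//.
apply: le_trans E _; rewrite ler_peMr ?expR_ge0//.
by rewrite ler_pdivlMr// mul1r.
Qed.

End Growth.

(** * Means of bounded functions *)

Section BoundedMeasurable.
Context {R : realType} {d : measure_display} {T : measurableType d}.
Implicit Types (G : set (set T)) (f g : T -> R).

(** [G] is only a generating family. The bound holds at every point, which makes the class stable
    under products and, for a probability, integrable. *)
Definition bounded_mfun G f :=
  measurable_fun setT (f : g_sigma_algebraType G -> R) /\
  exists K : R, forall w, `|f w| <= K.

Lemma bounded_mfun_cst G (c : R) : bounded_mfun G (fun=> c).
Proof. by split; [exact: measurable_cst|exists `|c|]. Qed.

Lemma bounded_mfunD G f g : bounded_mfun G f -> bounded_mfun G g ->
  bounded_mfun G (fun w => f w + g w).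
Proof.
move=> [mf [K HK]] [mg [L HL]]; split; first exact: measurable_funD.
by exists (K + L) => w; apply: le_trans (ler_normD _ _) _; rewrite lerD.
Qed.

Lemma bounded_mfunM G f g : bounded_mfun G f -> bounded_mfun G g ->
  bounded_mfun G (fun w => f w * g w).
Proof.
move=> [mf [K HK]] [mg [L HL]]; split; first exact: measurable_funM.
by exists (K * L) => w; rewrite normrM ler_pM.
Qed.

Lemma bounded_mfunB G f g : bounded_mfun G f -> bounded_mfun G g ->
  bounded_mfun G (fun w => f w - g w).
Proof.
move=> [mf [K HK]] [mg [L HL]]; split; first exact: measurable_funB.
by exists (K + L) => w; apply: le_trans (ler_normB _ _) _; rewrite lerD.
Qed.

Lemma bounded_mfun_indic G (A : set T) : <<s G >> A -> bounded_mfun G \1_A.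
Proof.
move=> GA; split; first exact: (@measurable_indic _ (g_sigma_algebraType G)).
by exists 1 => w; rewrite indicE; case: (_ \in _); rewrite ?normr1 ?normr0.
Qed.

Lemma bounded_mfun_comp G (h : R -> R) f : measurable_fun setT h ->
  (exists K, forall w, `|h (f w)| <= K) -> bounded_mfun G f ->
  bounded_mfun G (fun w => h (f w)).
Proof. by move=> mh hK [mf _]; split => //; exact: measurableT_comp. Qed.

Lemma bounded_mfun_sum G n (F : 'I_n -> T -> R) :
  (forall i, bounded_mfun G (F i)) -> bounded_mfun G (fun w => \sum_(i < n) F i w).
Proof.
move=> HF; elim: n F HF => [|n IH] F HF.
  by under eq_fun do rewrite big_ord0; exact: bounded_mfun_cst.
under eq_fun do rewrite big_ord_recr/=.
by apply: bounded_mfunD => //; apply: IH.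
Qed.

Lemma bounded_mfun_preimage G f (B : set R) : bounded_mfun G f -> measurable B ->
  <<s G >> (f @^-1` B).
Proof. by move=> [mf _] mB; have := mf measurableT _ mB; rewrite setTI. Qed.

Lemma bounded_mfun_sub G G' f : <<s G >> `<=` <<s G' >> ->
  bounded_mfun G f -> bounded_mfun G' f.
Proof.
move=> GG' [mf bf]; split => // _ B mB.
by have := mf measurableT _ mB; exact: GG'.
Qed.

Lemma bounded_mfunP f : bounded_mfun measurable f <->
  measurable_fun setT f /\ exists K, forall w, `|f w| <= K.
Proof.
have E : <<s (@measurable _ T) >> = measurable.
  exact/sigma_algebra_id/sigma_algebra_measurable.
split=> -[mf bf]; split => // _ B mB; have := mf measurableT _ mB.
  by rewrite /measurable/= E.
by move=> ?; rewrite /measurable/= E.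
Qed.

End BoundedMeasurable.

Section Expectation.
Context {R : realType} {d : measure_display} {T : measurableType d}
  (P : probability T R).
Implicit Types f g : T -> R.

Definition bmf f := bounded_mfun (@measurable _ T) f.

Definition mean f := Rintegral P setT f.

Lemma bmf_integrable f : bmf f -> P.-integrable setT (EFin \o f).
Proof.
move=> /bounded_mfunP[mf [K HK]]; apply: measurable_bounded_integrable => //.
  exact: (le_lt_trans (probability_le1 P measurableT) (ltry 1)).
exists K; split; first exact: num_real.
by move=> x Kx w _ /=; rewrite (le_trans (HK w))// ltW.
Qed.

Lemma eq_mean f g : (forall w, f w = g w) -> mean f = mean g.
Proof. by move=> fg; congr mean; apply/funext. Qed.

Lemma meanD f g : bmf f -> bmf g -> mean (fun w => f w + g w) = mean f + mean g.
Proof. by move=> bf bg; rewrite /mean RintegralD//; exact: bmf_integrable. Qed.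

Lemma meanB f g : bmf f -> bmf g -> mean (fun w => f w - g w) = mean f - mean g.
Proof. by move=> bf bg; rewrite /mean RintegralB//; exact: bmf_integrable. Qed.

Lemma meanZ (c : R) f : bmf f -> mean (fun w => c * f w) = c * mean f.
Proof. by move=> bf; rewrite /mean RintegralZl//; exact: bmf_integrable. Qed.

Lemma mean_cst (c : R) : mean (fun=> c) = c.
Proof.
rewrite /mean Rintegral_cst// (_ : fine _ = 1) ?mulr1//.
by have /= -> := @probability_setT _ _ _ P.
Qed.

Lemma le_mean f g : bmf f -> bmf g -> (forall w, f w <= g w) -> mean f <= mean g.
Proof. by move=> bf bg fg; apply: le_Rintegral => //; exact: bmf_integrable. Qed.

Lemma mean_ge0 f : (forall w, 0 <= f w) -> 0 <= mean f.
Proof. by move=> f0; exact: Rintegral_ge0. Qed.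

Lemma mean_sum n (F : 'I_n -> T -> R) : (forall i, bmf (F i)) ->
  mean (fun w => \sum_(i < n) F i w) = \sum_(i < n) mean (F i).
Proof.
move=> HF; elim: n F HF => [|n IH] F HF.
  by rewrite big_ord0; under eq_fun do rewrite big_ord0; exact: mean_cst.
rewrite big_ord_recr/= -IH -?meanD//; last by apply: bounded_mfun_sum => i; exact: HF.
by apply: eq_mean => w; rewrite big_ord_recr.
Qed.

Lemma mean_indic (A : set T) : measurable A -> (mean \1_A)%:E = P A.
Proof.
move=> mA; rewrite /mean /Rintegral integral_indic// setIT fineK//.
exact: fin_num_measure.
Qed.

Lemma bmf_indic (A : set T) : measurable A -> bmf \1_A.
Proof.
by move=> mA; apply: bounded_mfun_indic; exact: sub_sigma_algebra.
Qed.

Lemma bounded_convergence (f_ : nat -> T -> R) f (K : R) :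
  (forall n, bmf (f_ n)) -> bmf f ->
  (forall n w, `|f_ n w| <= K) ->
  {ae P, forall w, f_ n w @[n --> \oo] --> f w} ->
  mean (f_ n) @[n --> \oo] --> mean f.
Proof.
move=> bf_ bf HK cv.
have [|||||_ _ H] := @dominated_convergence _ _ _ P setT measurableT
  (fun n w => (f_ n w)%:E) (EFin \o f) (fun=> K%:E).
- by move=> n; apply/measurable_EFinP; case/bounded_mfunP: (bf_ n).
- by apply/measurable_EFinP; case/bounded_mfunP: bf.
- by apply: filterS cv => w cw _; apply: cvg_EFin => //; exact: nearW.
- exact: (@bmf_integrable (fun=> K) (bounded_mfun_cst _ K)).
- by apply: aeW => w n _ /=; rewrite lee_fin.
apply: fine_cvg; apply: cvg_trans H _.
rewrite /mean /Rintegral fineK//.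
exact: integrable_fin_num (bmf_integrable _ bf).
Qed.

End Expectation.

(** * From indicators to bounded test functions *)

Section Projection.
Context {R : realType}.

(** The sum counts the positive integers up to [x], so it is the integer part of [x]. *)
Let count_bounds (x : R) (J : nat) : 0 <= x <= J%:R ->
  x - 1 <= \sum_(j < J) (j.+1%:R <= x)%R%:R <= x.
Proof.
elim: J => [|J IH] in x * => [/andP[x0 x1]|/andP[x0 xJ]].
  by rewrite big_ord0 x0 andbT; lra.
rewrite big_ord_recr/=; have [xJ'|Jx] := leP x J%:R.
  have -> : (J.+1%:R <= x) = false.
    by apply/negbTE; rewrite -ltNge (le_lt_trans xJ')// ltr_nat.
  by rewrite addr0; apply: IH; rewrite x0.
have -> : \sum_(j < J) ((j.+1%:R <= x)%R%:R : R) = J%:R.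
  rewrite (eq_bigr (fun=> 1)); first by rewrite sumr_const card_ord.
  by move=> j _; rewrite (le_trans _ (ltW Jx))// ler_nat.
move: xJ; rewrite -natr1 => xJ.
by have [h|h] /= := leP (J%:R + 1) x; apply/andP; split; lra.
Qed.

Context {d : measure_display} {T : measurableType d} (P : probability T R).

(* The uniform approximation of [f] by [\sum_j 1_{f >= j / n} / n] reduces
   the claim to indicators. *)
Lemma mean_mul_eq0 (G : set (set T)) (h f : T -> R) (K : R) :
  <<s G >> `<=` measurable -> bmf h -> (forall w, `|h w| <= 1) ->
  (forall A, <<s G >> A -> mean P (fun w => h w * \1_A w) = 0) ->
  bounded_mfun G f -> (forall w, 0 <= f w <= K) ->
  mean P (fun w => h w * f w) = 0.
Proof.
move=> Gm bh h1 H0 bf fK.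
have sG : <<s G >> `<=` <<s (@measurable _ T) >>.
  by move=> A /Gm; exact: sub_sigma_algebra.
have bfT : bmf f by exact: bounded_mfun_sub bf.
apply/eqP; rewrite -normr_le0; apply/ler_addgt0Pl => e e0; rewrite addr0.
have [n n0 Hn] : exists2 n, (0 < n)%N & n%:R^-1 <= e.
  exists (Num.truncn e^-1).+1 => //.
  by rewrite invf_ple ?posrE ?ltr0n// ltW// truncnS_gt.
pose J := (Num.truncn (n%:R * K)).+1.
pose A (j : 'I_J) := [set w | j.+1%:R <= n%:R * f w].
have GA j : <<s G >> (A j).
  have -> : A j = (fun w => n%:R * f w) @^-1` `[j.+1%:R, +oo[.
    by apply/seteqP; split => w /=; rewrite /A/= in_itv/= andbT.
  apply: bounded_mfun_preimage => //.
  by apply: bounded_mfunM => //; exact: bounded_mfun_cst.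
pose g w : R := \sum_(j < J) \1_(A j) w.
have bg : bmf g.
  by apply: bounded_mfun_sum => j; apply: bmf_indic; exact: Gm.
have gE w : g w = \sum_(j < J) (j.+1%:R <= n%:R * f w)%R%:R.
  apply: eq_bigr => j _; rewrite indicE; congr (nat_of_bool _)%:R.
  by apply/idP/idP; rewrite inE.
have gb w : n%:R * f w - 1 <= g w <= n%:R * f w.
  rewrite gE; apply: count_bounds; have /andP[f0 f1] := fK w.
  rewrite mulr_ge0//= ltW//; apply: le_lt_trans (truncnS_gt _).
  by rewrite ler_wpM2l.
have hg0 : mean P (fun w => h w * g w) = 0.
  rewrite (@eq_mean _ _ _ P _ (fun w => \sum_(j < J) h w * \1_(A j) w)); last first.
    by move=> w; rewrite mulr_sumr.
  rewrite mean_sum; last first.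
    by move=> j; apply: bounded_mfunM => //; apply: bmf_indic; exact: Gm.
  by rewrite big1// => j _; exact: H0.
have nR : (0 : R) < n%:R by rewrite ltr0n.
have bnf : bmf (fun w => n%:R * f w).
  by apply: bounded_mfunM => //; exact: bounded_mfun_cst.
(* Subtracting [g] is free because [h] is orthogonal to the indicators. The remaining factor
   [n * f - g] lies in [0, 1], so the mean of [h * f] is at most [1 / n <= e] in absolute value. *)
have E : n%:R * mean P (fun w => h w * f w) = mean P (fun w => h w * (n%:R * f w - g w)).
  rewrite (@eq_mean _ _ _ P (fun w => h w * (n%:R * f w - g w))
    (fun w => n%:R * (h w * f w) - h w * g w)); last by move=> w; ring.
  rewrite meanB ?meanZ ?hg0 ?subr0//; try (exact: bounded_mfunM).
  by apply: bounded_mfunM; [exact: bounded_mfun_cst|exact: bounded_mfunM].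
have bd : bmf (fun w => h w * (n%:R * f w - g w)).
  by apply: bounded_mfunM => //; exact: bounded_mfunB.
have d1 w : -1 <= h w * (n%:R * f w - g w) <= 1.
  rewrite -ler_norml normrM mulr_ile1// ler_norml.
  by have /andP[] := gb w; lra.
apply: le_trans Hn; rewrite -(ler_pM2l nR) divff ?gt_eqF// -[X in X * _]gtr0_norm//.
rewrite -normrM E ler_norml; apply/andP; split.
  rewrite -[leLHS](mean_cst P); apply: le_mean => //; first exact: bounded_mfun_cst.
  by move=> w; case/andP: (d1 w).
rewrite -[leRHS](mean_cst P); apply: le_mean => //; first exact: bounded_mfun_cst.
by move=> w; case/andP: (d1 w).
Qed.


End Projection.

(** * The scalar reinforced martingale *)

Section Urn.
Context {R : realType} {d : measure_display} {T : measurableType d}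
  (P : probability T R).

(* [D n] is the reinforcement drawn at time [n + 1]. *)
Record is_urn (r : nat -> R) (F : nat -> set (set T)) (M D : nat -> T -> R) : Prop := {
  urn_sub : forall n, <<s F n >> `<=` measurable;
  urn_mono : forall n, <<s F n >> `<=` <<s F n.+1 >>;
  urn_M01 : forall n w, 0 <= M n w <= 1;
  urn_D01 : forall n w, 0 <= D n w <= 1;
  urn_adapted : forall n, bounded_mfun (F n) (M n);
  urn_D_meas : forall n, bmf (D n);
  urn_step : forall n w, M n.+1 w = (1 - r n) * M n w + r n * D n w;
  urn_mean : forall n A, <<s F n >> A -> mean P (fun w => (D n w - M n w) * \1_A w) = 0 }.

Context (r : nat -> R) (F : nat -> set (set T)) (M D : nat -> T -> R).
Hypothesis r01 : forall n, 0 <= r n < 1.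
Hypothesis HU : is_urn r F M D.

Lemma urn_le_mono m n : (m <= n)%N -> <<s F m >> `<=` <<s F n >>.
Proof.
move=> /subnK <-; elim: (n - m)%N => [//|k IH].
by rewrite addSn; apply: subset_trans IH _; exact: urn_mono HU _.
Qed.

Lemma bmf_adapted n (f : T -> R) : bounded_mfun (F n) f -> bmf f.
Proof.
apply: bounded_mfun_sub => A /(urn_sub _ _ _ _ HU); exact: sub_sigma_algebra.
Qed.

Lemma bmf_M n : bmf (M n).
Proof. exact/bmf_adapted/(urn_adapted _ _ _ _ HU). Qed.

(** By [mean_mul_eq0] applied to [h = D n - M n], the draw may be replaced by its conditional mean
    against any such test function known at time [n]. *)
Lemma mean_D_M n (f : T -> R) (K : R) : bounded_mfun (F n) f -> (forall w, 0 <= f w <= K) ->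
  mean P (fun w => D n w * f w) = mean P (fun w => M n w * f w).
Proof.
move=> bf fK.
have bfT : bmf f by exact: bmf_adapted bf.
have bD := urn_D_meas _ _ _ _ HU n; have bM := bmf_M n.
apply/eqP; rewrite -subr_eq0 -meanB; [|exact: bounded_mfunM..].
apply/eqP; rewrite (@eq_mean _ _ _ P _ (fun w => (D n w - M n w) * f w)); last first.
  by move=> w; rewrite mulrBl.
apply: (@mean_mul_eq0 _ _ _ P (F n) _ _ K) => //.
- exact: urn_sub HU _.
- exact: bounded_mfunB.
- move=> w; have := urn_D01 _ _ _ _ HU n w; have := urn_M01 _ _ _ _ HU n w.
  by rewrite ler_norml => /andP[? ?] /andP[? ?]; apply/andP; split; lra.
- exact: urn_mean HU _.
Qed.

Lemma bounded_mfun_expM G n (a : R) : bounded_mfun G (M n) ->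
  bounded_mfun G (fun w => expR (- (a * M n w))).
Proof.
move=> bM; apply: (@bounded_mfun_comp _ _ _ G (fun x => expR (- (a * x)))) => //.
  apply: (measurableT_comp (@measurable_expR R)).
  by apply: measurable_funN; exact: mulrl_measurable.
exists (expR `|a|) => w; rewrite ger0_norm ?expR_ge0// ler_expR.
have /andP[M0 M1] := urn_M01 _ _ _ _ HU n w.
rewrite (le_trans (ler_norm _))// normrN normrM (ger0_norm M0).
by rewrite ler_piMr.
Qed.

(* Convexity of [exp] in the draw. *)
Lemma mean_expM_step n (A : set T) (a : R) : <<s F n >> A -> 0 <= a ->
  mean P (fun w => \1_A w * expR (- (a * M n.+1 w))) <=
  mean P (fun w => \1_A w * expR (- ((a - a ^+ 2 * r n ^+ 2) * M n w))).
Proof.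
move=> FA a0; have mA : measurable A by exact: urn_sub HU _ _ FA.
have /andP[r0 r1] := r01 n.
have bA : bmf (\1_A : T -> R) by exact: bmf_indic.
have bM := bmf_M n; have bD := urn_D_meas _ _ _ _ HU n.
have i01 w : 0 <= (\1_A w : R) <= 1.
  by rewrite indicE; case: (_ \in _); rewrite ?lexx ler01.
pose f w : R := \1_A w * expR (- (a * (1 - r n) * M n w)).
have bfF : bounded_mfun (F n) f.
  apply: bounded_mfunM; first exact: bounded_mfun_indic.
  by apply: bounded_mfun_expM; exact: urn_adapted HU _.
have bf : bmf f by exact: bmf_adapted bfF.
have f01 w : 0 <= f w <= 1.
  rewrite /f mulr_ge0 ?expR_ge0//=.
  have /andP[i0 i1] := i01 w; apply: mulr_ile1 => //.
  rewrite expR_le1 oppr_le0; have /andP[M0 _] := urn_M01 _ _ _ _ HU n w.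
  by rewrite !mulr_ge0// subr_ge0 ltW.
(* By the chord inequality [exp (- a * r n * D) <= 1 - c * D], which is affine in the draw, so
   [mean_D_M] applies. *)
pose c := 1 - expR (- (a * r n)).
have c0 : 0 <= c by rewrite subr_ge0 expR_le1 oppr_le0 mulr_ge0.
have cc (h : T -> R) : bmf h -> bmf (fun w => f w - c * (h w * f w)).
  move=> bh; apply: bounded_mfunB => //.
  by apply: bounded_mfunM; [exact: bounded_mfun_cst|exact: bounded_mfunM].
have cm (h : T -> R) : bmf h ->
    mean P (fun w => f w - c * (h w * f w)) = mean P f - c * mean P (fun w => h w * f w).
  move=> bh; rewrite meanB ?meanZ//; first exact: bounded_mfunM.
  by apply: bounded_mfunM; [exact: bounded_mfun_cst|exact: bounded_mfunM].
apply: le_trans (_ : _ <= mean P (fun w => f w - c * (D n w * f w))) _.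
  apply: le_mean; [|exact: cc|].
    by apply: bounded_mfunM => //; apply: bounded_mfun_expM; exact: bmf_M.
  move=> w; rewrite /f (urn_step _ _ _ _ HU).
  have -> : - (a * ((1 - r n) * M n w + r n * D n w)) =
    - (a * (1 - r n) * M n w) + D n w * (- (a * r n)) by ring.
  rewrite expRD.
  have ch := expR_chord (D n w) (- (a * r n)) (urn_D01 _ _ _ _ HU n w).
  have e0 := expR_ge0 (- (a * (1 - r n) * M n w)); have /andP[i0 _] := i01 w.
  have := ler_wpM2l (mulr_ge0 i0 e0) ch; rewrite /c -mulrA; lra.
rewrite cm// (mean_D_M n f 1)// -cm//.
apply: le_mean; [exact: cc| |].
  by apply: bounded_mfunM => //; apply: bounded_mfun_expM; exact: bmf_M.
move=> w; rewrite /f; have /andP[i0 _] := i01 w.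
rewrite [leLHS](_ : _ = \1_A w * (expR (- (a * (1 - r n) * M n w)) * (1 - c * M n w))); last by ring.
rewrite ler_wpM2l//.
have /andP[M0 M1] := urn_M01 _ _ _ _ HU n w.
have -> : - ((a - a ^+ 2 * r n ^+ 2) * M n w) =
  - (a * (1 - r n) * M n w) + - ((a * r n - (a * r n) ^+ 2) * M n w) by ring.
rewrite expRD ler_wpM2l ?expR_ge0//.
(* It remains to see [c >= a * r n - (a * r n) ^ 2], which is [expRN_le_quad]. *)
apply: le_trans (expR_ge1Dx _); rewrite lerD2l lerN2 ler_wpM2r//.
have := expRN_le_quad (a * r n); rewrite mulr_ge0// => /(_ isT).
by rewrite /c; lra.
Qed.

(** An exponential supermartingale with varying exponent: [mu] grows with time just enough to pay
    for the quadratic loss in [mean_expM_step]. *)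
Lemma mean_expM_le n (A : set T) (t K : R) (j : nat) :
  <<s F n >> A -> 0 < t -> (forall j, \sum_(i < j) r (n + i)%N ^+ 2 <= t) ->
  (forall w, A w -> K * t <= M n w) ->
  mean P (fun w => \1_A w * expR (- ((2 * t)^-1 * M (n + j)%N w))) <=
  expR (- (K / 4)) * mean P \1_A.
Proof.
move=> FA t0 Ht AK; have mA : measurable A by exact: urn_sub HU _ _ FA.
have bA : bmf (\1_A : T -> R) by exact: bmf_indic.
(* With this [l] the total loss [l ^ 2 * t] equals [l / 2], so [mu] starts at [l / 2] and never
   exceeds [l]. On [A] the initial exponent is at most [- l / 2 * (K * t) = - K / 4]. *)
pose l : R := (2 * t)^-1; have l0 : 0 < l by rewrite invr_gt0 mulr_gt0.
pose mu j : R := l / 2 + l ^+ 2 * \sum_(i < j) r (n + i)%N ^+ 2.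
have lt2 : l * t = 1 / 2 by rewrite /l; field; rewrite gt_eqF.
have mu_le i : mu i <= l.
  rewrite /mu; have := ler_wpM2l (ltW (exprn_gt0 2 l0)) (Ht i).
  have -> : l ^+ 2 * t = l / 2 by rewrite expr2 -mulrA lt2; ring.
  by lra.
have mu_ge0 i : 0 <= mu i.
  rewrite /mu addr_ge0 ?mulr_ge0 ?sqr_ge0 ?(ltW l0) ?invr_ge0//.
  by apply: sumr_ge0 => k _; exact: sqr_ge0.
have bI (a : R) i : bmf (fun w => \1_A w * expR (- (a * M i w))).
  by apply: bounded_mfunM => //; apply: bounded_mfun_expM; exact: bmf_M.
have i0 w : 0 <= (\1_A w : R) by rewrite indicE.
have mono (a b : R) i : a <= b -> mean P (fun w => \1_A w * expR (- (b * M i w))) <=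
    mean P (fun w => \1_A w * expR (- (a * M i w))).
  move=> ab; apply: le_mean => // w; rewrite ler_wpM2l// ler_expR lerN2 ler_wpM2r//.
  by case/andP: (urn_M01 _ _ _ _ HU i w).
apply: le_trans (mono _ _ _ (mu_le j)) _.
have IH : mean P (fun w => \1_A w * expR (- (mu j * M (n + j)%N w))) <=
    mean P (fun w => \1_A w * expR (- (mu 0%N * M n w))).
  elim: j => [|j IH]; first by rewrite addn0.
  apply: le_trans IH; rewrite addnS.
  apply: le_trans (mean_expM_step _ _ _ _ (mu_ge0 _)) _.
    by apply: urn_le_mono FA; exact: leq_addr.
  apply: mono; have E : mu j.+1 = mu j + l ^+ 2 * r (n + j)%N ^+ 2.
    by rewrite /mu big_ord_recr/=; ring.
  have : mu j.+1 ^+ 2 * r (n + j)%N ^+ 2 <= l ^+ 2 * r (n + j)%N ^+ 2.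
    by rewrite ler_wpM2r ?sqr_ge0// ler_sqr ?nnegrE ?(ltW l0).
  by rewrite E; lra.
apply: le_trans IH _; rewrite -meanZ//; apply: le_mean => //.
  by apply: bounded_mfunM => //; exact: bounded_mfun_cst.
move=> w; rewrite [leRHS]mulrC.
have [Aw|nAw] := pselect (A w); last first.
  by rewrite indicE memNset// !mul0r.
rewrite ler_wpM2l// ler_expR lerN2 /mu big_ord0 mulr0 addr0.
have := ler_wpM2l (ltW l0) (AK w Aw).
by rewrite mulrCA lt2; lra.
Qed.

End Urn.

(** * Low and high values of the ratio [M / cprod] *)

Section UrnLimit.
Context {R : realType} {d : measure_display} {T : measurableType d}
  (P : probability T R).
Context (r : nat -> R) (F : nat -> set (set T)) (M D : nat -> T -> R).
Hypothesis r01 : forall n, 0 <= r n < 1.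
Hypothesis HU : is_urn P r F M D.
Let M01 := urn_M01 _ _ _ _ _ HU.
Let D01 := urn_D01 _ _ _ _ _ HU.

(** Where the limit is 0 the exponential in [mean_expM_le] tends to 1, so its bound passes to the
    indicator by bounded convergence. *)
Lemma mean_indic_limit0_le (Zinf : T -> R) n (A : set T) (t K : R) :
  measurable_fun setT Zinf ->
  {ae P, forall w, M k w @[k --> \oo] --> Zinf w} ->
  <<s F n >> A -> 0 < t -> (forall j, \sum_(i < j) r (n + i)%N ^+ 2 <= t) ->
  (forall w, A w -> K * t <= M n w) ->
  mean P \1_(A `&` [set w | Zinf w = 0]) <= expR (- (K / 4)) * mean P \1_A.
Proof.
move=> mZ cv FA t0 Ht AK; have mA : measurable A by exact: urn_sub HU _ _ FA.
set B := A `&` _.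
have mB : measurable B.
  apply: measurableI => //.
  have -> : [set w | Zinf w = 0] = Zinf @^-1` [set 0] by [].
  by rewrite -[X in measurable X]setTI; exact: mZ.
pose l : R := (2 * t)^-1; have l0 : 0 < l by rewrite invr_gt0 mulr_gt0.
have bA : bmf (\1_A : T -> R) by exact: bmf_indic.
have bB : bmf (\1_B : T -> R) by exact: bmf_indic.
pose f k w : R := \1_B w * expR (- (l * M (n + k)%N w)).
have be k : bmf (fun w => expR (- (l * M (n + k)%N w))).
  by apply: (bounded_mfun_expM _ _ _ _ _ HU); exact: bmf_M HU _.
have e1 k w : expR (- (l * M (n + k)%N w)) <= 1.
  by rewrite expR_le1 oppr_le0 mulr_ge0 ?(ltW l0)//; case/andP: (M01 (n + k)%N w).
have bf k : bmf (f k) by exact: bounded_mfunM bB (be k).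
have lim : mean P (f k) @[k --> \oo] --> mean P \1_B.
  apply: (@bounded_convergence _ _ _ P _ _ 1) => //.
    move=> k w; rewrite /f indicE; case: (_ \in _); rewrite ?mul0r ?normr0//.
    by rewrite mul1r ger0_norm ?expR_ge0.
  apply: filterS cv => w cw; rewrite /f indicE.
  have [/set_mem[_ /= Z0]|_] := boolP (w \in B); last first.
    by rewrite (_ : (fun=> _) = (fun=> 0)); [exact: cvg_cst|apply/funext => k; rewrite mul0r].
  rewrite (_ : (fun n0 => _) = (fun k => expR (- (l * M (n + k)%N w)))); last first.
    by apply/funext => k; rewrite mul1r.
  rewrite Z0 in cw.
  rewrite (_ : true%:R = expR (- (l * 0))); last by rewrite mulr0 oppr0 expR0.
  apply: (@cvg_comp _ _ _ (fun k => - (l * M (n + k)%N w)) expR); last exact: continuous_expR.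
  apply: cvgN; apply: cvgMr => //.
  have : [sequence M (k + n)%N w]_k @ \oo --> (0 : R) by rewrite (cvg_shiftn n (fun k => M k w)).
  by apply: cvg_trans; apply: near_eq_cvg; apply: nearW => k /=; rewrite addnC.
have H := mean_expM_le P _ _ _ _ r01 HU n A t K _ FA t0 Ht AK.
rewrite -(cvg_lim _ lim)//; apply: limr_le; first by apply/cvg_ex; eexists; exact: lim.
apply: nearW => k; apply: le_trans (H k); apply: le_mean => //.
  exact: bounded_mfunM bA (be k).
move=> w; rewrite /f ler_wpM2r ?expR_ge0// !indicE ler_nat.
by case: (boolP (w \in B)) => // /set_mem[Aw _]; rewrite mem_set.
Qed.

Lemma urn_lt_adapted n (c : R) : <<s F n >> [set w | M n w < c].
Proof.
rewrite (_ : [set w | _] = M n @^-1` `]-oo, c[).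
  by apply: bounded_mfun_preimage => //; exact: urn_adapted HU _.
by apply/seteqP; split => w /=; rewrite in_itv.
Qed.

(** Division by [cprod] cancels the deterministic decay and leaves only the nonnegative jumps due to
    the draws. *)
Lemma urn_ratio_step n w :
  M n.+1 w / cprod r n.+1 = M n w / cprod r n + r n / cprod r n.+1 * D n w.
Proof.
rewrite (urn_step _ _ _ _ _ HU) cprodS.
have c0 := cprod_gt0 r r01 n; have /andP[_ r1] := r01 n.
by field; rewrite !gt_eqF ?subr_gt0.
Qed.

Lemma urn_ratio_mono m n w : (m <= n)%N ->
  M m w / cprod r m <= M n w / cprod r n.
Proof.
move=> /subnK <-; elim: (n - m)%N => [//|k IH].
rewrite addSn urn_ratio_step; apply: le_trans IH _; rewrite lerDl.
have /andP[D0 _] := D01 (k + m) w; have /andP[r0 _] := r01 (k + m).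
by rewrite mulr_ge0 ?divr_ge0 ?cprod_ge0.
Qed.

Context (A : set T) (e C K : R) (m : nat).
Hypothesis A_F0 : <<s F 0%N >> A.
Hypothesis A_ge : forall w, A w -> e <= M 0%N w.
Hypothesis e0 : 0 < e.
Hypothesis C0 : 0 < C.
Hypothesis K0 : 0 < K.
Hypothesis rate : forall n, (m <= n)%N -> r n <= C * (cprod r n.+1 * rsum r n.+1).
Hypothesis m1 : 1 <= rsum r m.

(** These events encode, without a stopping time, that on [A] the ratio [M / cprod] has not yet
    reached [K * rsum] since time [m]. *)
Fixpoint stay i : set T :=
  if i is j.+1 then
    stay j `&` [set w | M (m + j)%N w < K * (cprod r (m + j) * rsum r (m + j))]
  else A.

Lemma stay_mono i j : (i <= j)%N -> stay j `<=` stay i.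
Proof.
move=> /subnK <-; elim: (j - i)%N => [//|k IH].
by rewrite addSn => w /= [/IH].
Qed.

(** The last value inspected by [stay i.+1] is at time [m + i], so its indicator is known before the
    draw [D (m + i)]. *)
Lemma stay_succ_adapted i :
  <<s F (m + i)%N >> (stay i) -> <<s F (m + i)%N >> (stay i.+1).
Proof.
move=> H; apply: (@measurableI _ (g_sigma_algebraType (F (m + i)%N))) => //.
exact: urn_lt_adapted.
Qed.

Lemma stay_adapted i : <<s F (m + i)%N >> (stay i).
Proof.
elim: i => [|i IH]; first by apply: urn_le_mono HU _ _ _ _ A_F0; exact: leq0n.
apply: (urn_le_mono _ _ _ _ _ HU (m + i)); first by rewrite addnS.
exact: stay_succ_adapted.
Qed.

Lemma stay_measurable i : measurable (stay i).
Proof. exact: urn_sub HU _ _ (stay_adapted i). Qed.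


Let ratio n w : R := M n w / cprod r n.
Let logr n w : R := ln (1 + ratio n w).

Let ratio_ge0 n w : 0 <= ratio n w.
Proof. by rewrite divr_ge0 ?cprod_ge0//; case/andP: (M01 n w). Qed.

Let rsum_gt0 n : (m <= n)%N -> 0 < rsum r n.
Proof. by move=> mn; rewrite (lt_le_trans _ (le_rsum _ r01 _ _ mn))// (lt_le_trans ltr01). Qed.

Lemma sum_logr_stay w j : stay j w ->
  \sum_(i < j) (logr (m + i).+1 w - logr (m + i)%N w) * \1_(stay i.+1) w =
  logr (m + j)%N w - logr m w.
Proof.
elim: j => [|j IH] sj; first by rewrite big_ord0 addn0 subrr.
rewrite big_ord_recr/= IH; last by case: sj.
by rewrite indicE mem_set// mulr1 addnS addrC addrA subrK.
Qed.

(** The sum freezes once the path leaves [stay]. Before that it telescopes, and the ratio is at most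
    [K * rsum] plus one last jump, which the rate condition bounds by [C * rsum]. *)
Lemma sum_logr_le w j :
  \sum_(i < j) (logr (m + i).+1 w - logr (m + i)%N w) * \1_(stay i.+1) w <=
  ln (1 + (K + C) * rsum r (m + j)).
Proof.
have p1 n : (m <= n)%N -> 0 <= (K + C) * rsum r n.
  by move=> /rsum_gt0 /ltW s0; rewrite mulr_ge0// addr_ge0 ?(ltW K0) ?(ltW C0).
elim: j => [|j IH]; first by rewrite big_ord0 ln_ge0// lerDl p1// leq_addr.
have [sj|nsj] := pselect (stay j.+1 w); last first.
  rewrite big_ord_recr/= [X in _ * X]indicE memNset// mulr0 addr0.
  apply: le_trans IH _.
  rewrite ler_ln ?posrE ?ltr_pwDl ?p1 ?leq_addr// lerD2l ler_wpM2l//.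
    by rewrite addr_ge0 ?(ltW K0) ?(ltW C0).
  by apply: le_rsum => //; rewrite addnS.
rewrite sum_logr_stay//.
have l0 : 0 <= logr m w by rewrite ln_ge0// lerDl ratio_ge0.
apply: le_trans (_ : _ <= logr (m + j.+1)%N w) _; first by rewrite gerBl.
rewrite ler_ln ?posrE ?ltr_pwDl ?p1 ?ratio_ge0 ?leq_addr// lerD2l.
rewrite addnS /ratio urn_ratio_step mulrDl lerD//.
  case: sj => _ /=; rewrite mulrCA => /ltW h.
  rewrite ler_pdivrMr ?cprod_gt0// mulrC; apply: le_trans h _.
  rewrite ler_wpM2l ?cprod_ge0// ler_wpM2l ?(ltW K0)//.
  by apply: le_rsum => //; exact: leqnSn.
have /andP[D0 D1] := D01 (m + j) w; have /andP[r0 _] := r01 (m + j).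
apply: le_trans (_ : _ <= r (m + j)%N / cprod r (m + j).+1) _.
  by rewrite ler_piMr// divr_ge0 ?cprod_ge0.
rewrite ler_pdivrMr ?cprod_gt0//; apply: le_trans (rate _ (leq_addr _ _)) _.
by rewrite mulrCA mulrC.
Qed.

(** The increment of [logr] that a full draw, [D n w = 1], would produce; it is known at time
    [n]. *)
Let incr n w : R := ln (1 + ratio n w + r n / cprod r n.+1) - logr n w.

(** By concavity of the logarithm, a partial draw yields at least its share of the full
    increment. *)
Lemma logr_incr_ge n w : D n w * incr n w <= logr n.+1 w - logr n w.
Proof.
have y0 : 0 < 1 + ratio n w by rewrite ltr_pwDl ?ratio_ge0.
have /andP[r0 _] := r01 n.
have q0 : 0 <= r n / cprod r n.+1 by rewrite divr_ge0 ?cprod_ge0.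
have /andP[D0 D1] := D01 n w.
have E : ratio n.+1 w = ratio n w + r n / cprod r n.+1 * D n w by exact: urn_ratio_step.
rewrite /incr /logr E.
rewrite -!ln_div ?posrE//; last 2 first.
- by rewrite addrA ltr_wpDr// mulr_ge0.
- by rewrite ltr_wpDr.
have -> : (1 + (ratio n w + r n / cprod r n.+1 * D n w)) / (1 + ratio n w) =
    1 + D n w * (r n / cprod r n.+1 / (1 + ratio n w)).
  by field; rewrite !gt_eqF ?cprod_gt0.
have -> : (1 + ratio n w + r n / cprod r n.+1) / (1 + ratio n w) =
    1 + r n / cprod r n.+1 / (1 + ratio n w).
  by field; rewrite !gt_eqF ?cprod_gt0.
by apply: ln_chord; [exact: D01|rewrite divr_ge0 ?(ltW y0)].
Qed.

(** A deterministic lower bound for the conditional drift of [logr]: [e / (1 + e)] bounds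
    [Y / (1 + Y)] from below for the ratio [Y >= e], and [C * rsum r n.+1] is the largest possible
    jump. *)
Let rate_lb n := e / (1 + e) / C * (r n * (ln (1 + C * rsum r n.+1) / rsum r n.+1)).

Let rate_lb_ge0 n : 0 <= rate_lb n.
Proof.
have /andP[r0 _] := r01 n.
have s0 := rsum_ge0 r r01 n.+1.
rewrite /rate_lb !mulr_ge0 ?invr_ge0 ?(ltW e0) ?(ltW C0) ?addr_ge0 ?(ltW e0)//.
by rewrite ln_ge0// lerDl mulr_ge0 ?(ltW C0).
Qed.

Lemma M_incr_ge n w : (m <= n)%N -> A w -> rate_lb n <= M n w * incr n w.
Proof.
move=> mn Aw.
have eY : e <= ratio n w.
  apply: le_trans (A_ge _ Aw) _; apply: le_trans (urn_ratio_mono _ _ w (leq0n n)).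
  by rewrite /cprod big_ord0 divr1.
have Y0 : 0 < 1 + ratio n w by rewrite ltr_pwDl ?ratio_ge0.
have /andP[r0 r1] := r01 n.
have c0 := cprod_gt0 _ r01 n; have c1 := cprod_gt0 _ r01 n.+1.
have s1 : 0 < rsum r n.+1 by apply: rsum_gt0; exact: leqW.
have j0 : 0 <= r n / cprod r n.+1 by rewrite divr_ge0 ?(ltW c1).
have jC : r n / cprod r n.+1 <= C * rsum r n.+1.
  by rewrite ler_pdivrMr//; apply: le_trans (rate _ mn) _; rewrite mulrCA mulrC.
have -> : M n w = ratio n w * cprod r n by rewrite /ratio divfK ?gt_eqF.
rewrite /incr /logr -ln_div ?posrE//; last by rewrite ltr_wpDr.
have -> : (1 + ratio n w + r n / cprod r n.+1) / (1 + ratio n w) =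
    1 + r n / cprod r n.+1 / (1 + ratio n w).
  by field; rewrite !gt_eqF.
set S := C * rsum r n.+1.
have S0 : 0 < S by rewrite mulr_gt0.
(* The relative jump is written as a fraction [x] of its maximal size [S], so that [ln_chord] gives
   [x * ln (1 + S)]. *)
set x := r n / cprod r n.+1 / (1 + ratio n w) / S.
have x01 : 0 <= x <= 1.
  apply/andP; split; first by rewrite /x !divr_ge0 ?(ltW Y0) ?(ltW S0) ?(ltW c1).
  rewrite /x ler_pdivrMr// mul1r.
  by rewrite ler_pdivrMr//; apply: le_trans jC _; rewrite ler_peMr ?(ltW S0)// lerDl ratio_ge0.
have -> : r n / cprod r n.+1 / (1 + ratio n w) = x * S by rewrite /x divfK ?gt_eqF.
have h := ln_chord x S x01 (ltW S0).
apply: le_trans (ler_wpM2l _ h); last by rewrite mulr_ge0 ?ratio_ge0 ?(ltW c0).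
have l0 : 0 <= ln (1 + S) by rewrite ln_ge0// lerDl (ltW S0).
rewrite /rate_lb -/S.
have -> : e / (1 + e) / C * (r n * (ln (1 + S) / rsum r n.+1)) =
  e / (1 + e) * (r n / S * ln (1 + S)).
  by rewrite /S; field; rewrite !gt_eqF// addr_gt0.
(* The ratio [cprod r n / cprod r n.+1] is [1 / (1 - r n) >= 1], a factor that is then dropped. *)
have -> : ratio n w * cprod r n * (x * ln (1 + S)) =
  ratio n w / (1 + ratio n w) / (1 - r n) * (r n / S * ln (1 + S)).
  rewrite /x cprodS; field.
  by rewrite !gt_eqF// subr_gt0.
rewrite ler_wpM2r//; first by rewrite !mulr_ge0 ?invr_ge0 ?(ltW S0).
apply: le_trans (_ : _ <= ratio n w / (1 + ratio n w)) _.
  rewrite ler_pdivlMr// mulrAC ler_pdivrMr; last by rewrite addr_gt0.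
  by lra.
rewrite ler_pdivlMr ?subr_gt0// ler_piMr//; first by rewrite divr_ge0 ?ratio_ge0 ?(ltW Y0).
by rewrite gerBl.
Qed.

Lemma bounded_mfun_lnM G n (a b : R) : 1 <= a -> 0 <= b ->
  bounded_mfun G (M n) -> bounded_mfun G (fun w => ln (a + b * M n w)).
Proof.
move=> a1 b0 bM; apply: (@bounded_mfun_comp _ _ _ G (fun x => ln (a + b * x))) => //.
  apply: (measurableT_comp (@measurable_ln R)).
  by apply: measurable_funD; [exact: measurable_cst|exact: mulrl_measurable].
have a0 : 0 < a by apply: lt_le_trans a1.
exists (ln (a + b)) => w; have /andP[M0 M1] := M01 n w.
have ab : 0 <= b * M n w by rewrite mulr_ge0.
rewrite ger0_norm; last by rewrite ln_ge0// (le_trans a1)// lerDl.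
by rewrite ler_ln ?posrE ?ltr_wpDr// lerD2l ler_piMr.
Qed.

Let bounded_mfun_logr G n : bounded_mfun G (M n) -> bounded_mfun G (logr n).
Proof.
move=> bM; rewrite (_ : logr n = fun w => ln (1 + (cprod r n)^-1 * M n w)).
  by apply: bounded_mfun_lnM => //; rewrite invr_ge0 cprod_ge0.
by apply/funext => w; rewrite /logr /ratio mulrC.
Qed.

Let bounded_mfun_incr n : bounded_mfun (F n) (incr n).
Proof.
have bM := urn_adapted _ _ _ _ _ HU n; have /andP[r0 _] := r01 n.
apply: bounded_mfunB; last exact: bounded_mfun_logr.
rewrite (_ : (fun w => _) =
  (fun w => ln ((1 + r n / cprod r n.+1) + (cprod r n)^-1 * M n w))).
  apply: bounded_mfun_lnM => //; last by rewrite invr_ge0 cprod_ge0.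
  by rewrite lerDl divr_ge0 ?cprod_ge0.
by apply/funext => w; rewrite /ratio mulrC addrAC.
Qed.

Let incr_ge0 n w : 0 <= incr n w.
Proof.
have /andP[r0 _] := r01 n.
have q0 : 0 <= r n / cprod r n.+1 by rewrite divr_ge0 ?cprod_ge0.
have Y0 : 0 < 1 + ratio n w by rewrite ltr_pwDl ?ratio_ge0.
by rewrite subr_ge0 ler_ln ?posrE ?ltr_wpDr// lerDl.
Qed.

(** Both [incr] and the indicator of [stay i.+1] are known at time [m + i], so the draw can be
    averaged to [M], and [M_incr_ge] applies on [A]. *)
Lemma mean_stay_step i : rate_lb (m + i) * mean P \1_(stay i.+1) <=
  mean P (fun w => (logr (m + i).+1 w - logr (m + i)%N w) * \1_(stay i.+1) w).
Proof.
set n := (m + i)%N; set B := stay i.+1.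
have FB : <<s F n >> B by apply: stay_succ_adapted; exact: stay_adapted.
have bB : bmf (\1_B : T -> R) by apply: bmf_indic; exact: stay_measurable.
have bM := bmf_M _ _ _ _ _ HU.
have bD := urn_D_meas _ _ _ _ _ HU n.
have bI : bmf (incr n) by apply: (bmf_adapted _ _ _ _ _ HU n); exact: bounded_mfun_incr.
have bfF : bounded_mfun (F n) (fun w => incr n w * \1_B w).
  by apply: bounded_mfunM; [exact: bounded_mfun_incr|exact: bounded_mfun_indic].
have bf : bmf (fun w => incr n w * \1_B w) by exact: bounded_mfunM.
have [L HL] := bfF.2.
have f0L w : 0 <= incr n w * \1_B w <= L.
  have f0 : 0 <= incr n w * \1_B w by rewrite mulr_ge0 ?incr_ge0.
  by rewrite f0/= -(ger0_norm f0).
apply: le_trans (_ : _ <= mean P (fun w => D n w * (incr n w * \1_B w))) _; last first.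
  apply: le_mean; first exact: bounded_mfunM.
    apply: bounded_mfunM => //.
    by apply: bounded_mfunB; apply: bounded_mfun_logr; exact: bM.
  move=> w; rewrite mulrA ler_wpM2r//.
  exact: logr_incr_ge.
rewrite (mean_D_M _ _ _ _ _ HU n _ L bfF f0L) -meanZ//; apply: le_mean.
- by apply: bounded_mfunM => //; exact: bounded_mfun_cst.
- by apply: bounded_mfunM => //; exact: bM.
move=> w; rewrite mulrA [\1_B w]indicE.
have [/set_mem Bw|_] := boolP (w \in B); last by rewrite !mulr0.
rewrite !mulr1; apply: M_incr_ge; first exact: leq_addr.
exact: (stay_mono 0 i.+1).
Qed.

(** The drifts are summed against the pathwise cap [sum_logr_le]; since the events decrease,
    [stay j] may replace each [stay i.+1]. *)
Lemma mean_stay_le j : (\sum_(i < j) rate_lb (m + i)) * mean P \1_(stay j) <=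
  ln (1 + (K + C) * rsum r (m + j)).
Proof.
have bS k : bmf (\1_(stay k) : T -> R) by apply: bmf_indic; exact: stay_measurable.
have bL n : bmf (logr n) by apply: bounded_mfun_logr; exact: bmf_M HU _.
have bI i : bmf (fun w => (logr (m + i).+1 w - logr (m + i)%N w) * \1_(stay i.+1) w).
  exact: bounded_mfunM _ _ _ (bounded_mfunB _ _ _ (bL _) (bL _)) (bS _).
apply: le_trans (_ : _ <= mean P (fun w => \sum_(i < j)
    (logr (m + i).+1 w - logr (m + i)%N w) * \1_(stay i.+1) w)) _.
  rewrite mean_sum// mulr_suml; apply: ler_sum => i _.
  apply: le_trans (mean_stay_step i); rewrite ler_wpM2l ?rate_lb_ge0//.
  apply: le_mean => // w; rewrite !indicE ler_nat.
  have [/set_mem sj|_] := boolP (w \in stay j) => //.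
  by rewrite mem_set//; exact: (stay_mono i.+1 j).
rewrite -[leRHS](mean_cst P); apply: le_mean.
- by apply: bounded_mfun_sum => i; exact: bI.
- exact: bounded_mfun_cst.
- by move=> w; exact: sum_logr_le.
Qed.

(** In [mean_stay_le] the sum of drifts grows like the square of [l n], whereas the cap is linear in
    [l n]. *)
Lemma mean_stay_small (dlt : R) : (forall B : R, exists n, B <= rsum r n) -> 0 < dlt ->
  exists j, mean P \1_(stay j) <= dlt.
Proof.
move=> Sinf d0.
pose l n := ln (1 + C * rsum r n).
pose a := e / (1 + e) / C / 4.
have a0 : 0 < a by rewrite !divr_gt0// addr_gt0.
(* Chosen for [1 + (K + C) * S <= (1 + K / C) * (1 + C * S)]. *)
pose kap := ln (1 + K / C).
have kap0 : 0 <= kap by rewrite ln_ge0// lerDl divr_ge0 ?(ltW K0) ?(ltW C0).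
pose b := l m ^+ 2.
have b0 : 0 <= b by exact: sqr_ge0.
(* Once [l n >= L], the quadratic [dlt * a * (l n ^ 2 - b)] exceeds [kap + l n]; the summand [l m]
   ensures [b <= l n ^ 2]. *)
pose L := 1 + (1 + kap + dlt * a * b) / (dlt * a) + l m.
have da0 : 0 < dlt * a by rewrite mulr_gt0.
have [n0 Hn0] := Sinf (expR L / C).
pose n := maxn m n0; have mn : (m <= n)%N by exact: leq_maxl.
have s1 : 1 <= rsum r n by apply: le_trans m1 (le_rsum _ r01 _ _ mn).
have Ln : L <= l n.
  rewrite /l -ler_expR lnK ?posrE; last by rewrite ltr_pwDl// mulr_ge0 ?(ltW C0)//; lra.
  rewrite -[leLHS]add0r lerD// -ler_pdivrMl// mulrC; apply: le_trans Hn0 _.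
  by apply: le_rsum => //; exact: leq_maxr.
exists (n - m)%N.
have := mean_stay_le (n - m); rewrite subnKC//.
set p := mean P _.
have p0 : 0 <= p by apply: mean_ge0 => w; rewrite indicE.
have -> : \sum_(i < n - m) rate_lb (m + i) = \sum_(m <= k < n) rate_lb k.
  rewrite -(big_mkord xpredT (fun i => rate_lb (m + i)%N)) -[in RHS](add0n m) big_addn.
  by apply: eq_bigr => i _; rewrite addnC.
have R1 : a * (l n ^+ 2 - b) <= \sum_(m <= k < n) rate_lb k.
  rewrite /rate_lb -mulr_sumr.
  have := sum_ln_rsum_ge r r01 C m n C0 m1 mn; rewrite -/(l n) -/(l m) -/b => h.
  have h1 : 0 <= e / (1 + e) / C by rewrite !divr_ge0 ?(ltW e0) ?(ltW C0) ?addr_ge0 ?(ltW e0).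
  by have := ler_wpM2l h1 h; rewrite /a; lra.
have R2 : ln (1 + (K + C) * rsum r n) <= kap + l n.
  have CS : 0 <= C * rsum r n by rewrite mulr_ge0 ?(ltW C0)//; lra.
  have KC : 0 < 1 + K / C by rewrite ltr_pwDl// divr_ge0 ?(ltW K0) ?(ltW C0).
  have KS : 0 <= (K + C) * rsum r n by rewrite mulr_ge0 ?addr_ge0 ?(ltW C0) ?(ltW K0)//; lra.
  have pS : 0 < 1 + C * rsum r n by rewrite ltr_pwDl.
  have pKS : 0 < 1 + (K + C) * rsum r n by rewrite ltr_pwDl.
  rewrite /kap /l -lnM ?posrE// ler_ln ?posrE ?mulr_gt0//.
  have -> : (1 + K / C) * (1 + C * rsum r n) = 1 + (K + C) * rsum r n + K / C.
    by field; rewrite gt_eqF.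
  by rewrite lerDl divr_ge0 ?(ltW K0) ?(ltW C0).
move=> H; rewrite leNgt; apply/negP => dp.
have lm0 : 0 <= l m by rewrite ln_ge0// lerDl mulr_ge0 ?(ltW C0) ?rsum_ge0.
have l1 : 1 <= l n.
  apply: le_trans Ln; rewrite /L -addrA lerDl addr_ge0// divr_ge0 ?(ltW da0)//.
  by rewrite !addr_ge0// mulr_ge0 ?(ltW da0).
have l2 : 1 + kap + dlt * a * b <= dlt * a * l n - dlt * a.
  have : (1 + kap + dlt * a * b) / (dlt * a) <= l n - 1.
    by move: Ln; rewrite /L; lra.
  by rewrite ler_pdivrMr// mulrBl mul1r [l n * _]mulrC.
have ln0 : 0 < l n by apply: lt_le_trans l1.
have l4 : (1 + kap + dlt * a * b) * l n <= (dlt * a * l n - dlt * a) * l n.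
  by rewrite ler_wpM2r// ltW.
have l6 : 0 < dlt * a * l n by rewrite mulr_gt0.
have q0 : 0 <= dlt * a * b by rewrite mulr_ge0 ?(ltW da0).
have bl : b <= l n ^+ 2.
  rewrite /b ler_sqr ?nnegrE//; last by lra.
  apply: le_trans Ln; rewrite /L lerDr addr_ge0// divr_ge0 ?(ltW da0)//.
  by rewrite !addr_ge0.
have l5 : dlt * (a * (l n ^+ 2 - b)) <= kap + l n.
  apply: le_trans R2; apply: le_trans H.
  apply: le_trans (_ : _ <= p * (a * (l n ^+ 2 - b))) _.
    by rewrite ler_wpM2r ?(ltW dp)// mulr_ge0 ?(ltW a0)// subr_ge0.
  by rewrite mulrC ler_wpM2r.
have : kap * l n >= kap by rewrite ler_peMr.
have : dlt * a * b * l n >= dlt * a * b by rewrite ler_peMr.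
by move: l4 l5 l6; lra.
Qed.

(** Either the path is still in [stay j], or it left at some earlier step. At the exit
    [M >= K * cprod * rsum], so [mean_indic_limit0_le] applies with [K / Ct] in place of [K]. *)
Lemma mean_limit0_le_stay (Zinf : T -> R) (Ct : R) (j : nat) :
  measurable_fun setT Zinf ->
  {ae P, forall w, M k w @[k --> \oo] --> Zinf w} -> 0 < Ct ->
  (forall n k, (m <= n)%N ->
    \sum_(i < k) r (n + i)%N ^+ 2 <= Ct * (cprod r n * rsum r n)) ->
  mean P \1_(A `&` [set w | Zinf w = 0]) <=
  mean P \1_(stay j) + expR (- (K / Ct / 4)).
Proof.
move=> mZ cv Ct0 Ht; set B := [set w | _]; set eps := expR _.
have eps0 : 0 <= eps by exact: expR_ge0.
have mB : measurable B.
  rewrite (_ : B = Zinf @^-1` [set 0])//.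
  by rewrite -[X in measurable X]setTI; exact: mZ.
have mS := stay_measurable.
have bI (E : set T) : measurable E -> bmf (\1_E : T -> R) by exact: bmf_indic.
(* The bound for paths that have left, with both subtracted terms moved across. Its induction step
   adds the exit event [E]. *)
have H : mean P \1_(A `&` B) + eps * mean P \1_(stay j) <=
    mean P \1_(stay j `&` B) + eps * mean P \1_A.
  elim: j => [//|j IH]; set E := stay j `\` stay j.+1.
  have mE : measurable E by apply: measurableD.
  have FE : <<s F (m + j)%N >> E.
    have H := stay_adapted j.
    apply: (@measurableD _ (g_sigma_algebraType (F (m + j)%N))) => //.
    exact: stay_succ_adapted.
  have s0 : 0 < rsum r (m + j) by apply: rsum_gt0; exact: leq_addr.
  have t0 : 0 < Ct * (cprod r (m + j) * rsum r (m + j)).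
    by rewrite !mulr_gt0// cprod_gt0.
  have EB : mean P \1_(E `&` B) <= eps * mean P \1_E.
    apply: (mean_indic_limit0_le _ _ _ _ _ mZ cv FE t0).
      by move=> k; apply: Ht; exact: leq_addr.
    move=> w [sw nsw]; rewrite mulrA divfK ?gt_eqF// leNgt; apply/negP => h.
    by apply: nsw; split.
  have E1 : mean P \1_E + mean P \1_(stay j.+1) <= mean P \1_(stay j).
    rewrite -meanD; [|exact: bI..].
    apply: le_mean; [|exact: bI|].
      by apply: bounded_mfunD; exact: bI.
    move=> w; rewrite !indicE /E in_setD -natrD ler_nat.
    have [/set_mem h|h] := boolP (w \in stay j.+1); last by rewrite addn0 andbT.
    by rewrite (mem_set (stay_mono j j.+1 (leqnSn j) w h)).
  have E2 : mean P \1_(stay j `&` B) <= mean P \1_(stay j.+1 `&` B) + mean P \1_(E `&` B).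
    rewrite -meanD; [|apply: bI; exact: measurableI..].
    apply: le_mean; [apply: bI; exact: measurableI| |].
      by apply: bounded_mfunD; apply: bI; exact: measurableI.
    move=> w; rewrite /E; move: (stay j) (stay j.+1) => S0 S1.
    rewrite !indicE in_setI [in leRHS]in_setI [w \in _ `&` B]in_setI in_setD -natrD ler_nat.
    by case: (w \in S0); case: (w \in S1); case: (w \in B).
  have := ler_wpM2l eps0 E1; rewrite mulrDr.
  by move: IH E2 EB; lra.
have A1 : mean P \1_A <= 1.
  rewrite -[leRHS](mean_cst P); apply: le_mean.
  - by apply: bI; exact: (mS 0%N).
  - exact: bounded_mfun_cst.
  - by move=> w; rewrite indicE; case: (_ \in _).
have SB : mean P \1_(stay j `&` B) <= mean P \1_(stay j).
  apply: le_mean; [apply: bI; exact: measurableI|exact: bI|].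
  by move=> w; rewrite !indicE in_setI ler_nat; case: (_ \in _); case: (_ \in _).
have S0 : 0 <= mean P \1_(stay j) by apply: mean_ge0 => w; rewrite indicE.
have := ler_wpM2l eps0 A1; have := mulr_ge0 eps0 S0.
by move: H SB; lra.
Qed.

End UrnLimit.

(** * The limit 0 is excluded when the martingale starts positive *)

Section UrnNonExtinction.
Context {R : realType} {d : measure_display} {T : measurableType d}
  (P : probability T R).
Context (r : nat -> R) (F : nat -> set (set T)) (M D : nat -> T -> R).
Hypothesis r01 : forall n, 0 <= r n < 1.
Hypothesis HU : is_urn P r F M D.

(** First [K] is taken so large that convergence to 0 after leaving [stay] is unlikely; then, for
    this [K], [j] so large that [stay j] is unlikely. *)
Lemma urn_limit_neq0_ge (Zinf : T -> R) (e : R) :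
  rate_exp r -> (forall B : R, exists n, B <= rsum r n) ->
  measurable_fun setT Zinf ->
  {ae P, forall w, M k w @[k --> \oo] --> Zinf w} -> 0 < e ->
  mean P \1_([set w | e <= M 0%N w] `&` [set w | Zinf w = 0]) = 0.
Proof.
move=> re Sinf mZ cv e0; set A := [set w | e <= _].
have FA : <<s F 0%N >> A.
  rewrite (_ : A = ~` [set w | M 0%N w < e]).
    by apply: sigma_algebraC; exact: urn_lt_adapted HU _ _.
  by apply/seteqP; split => w /=; [rewrite /A/= leNgt => /negP|move/negP; rewrite -leNgt].
have [C1 [k1 [C10 rate1]]] := (rate_prodP r r01).1 ((rate_exp_prod r r01).1 re).
have [C2 [k2 [C20 rate2]]] := (rate_expP r r01).1 re.
have [C3 [k3 [C30 rate3]]] := rate_exp_cprod r r01 re.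
have [k4 Hk4] := Sinf 1.
pose m := maxn (maxn k1 k2) (maxn k3 k4).
have [m1 m2 m3 m4] : [/\ (k1 <= m)%N, (k2 <= m)%N, (k3 <= m)%N & (k4 <= m)%N].
  by rewrite /m !leq_max !leqnn !orbT.
have sm : 1 <= rsum r m by apply: le_trans Hk4 (le_rsum _ r01 _ _ m4).
(* The 6 is [2 * 3]: the 2 comes from [sum_sqr_tail], and [rsum + 2 <= 3 * rsum] because
   [rsum >= 1]. *)
pose Ct := 6 * C2 * C3.
have Ct0 : 0 < Ct by rewrite !mulr_gt0.
have tail n k : (m <= n)%N ->
    \sum_(i < k) r (n + i)%N ^+ 2 <= Ct * (cprod r n * rsum r n).
  move=> mn; apply: le_trans (sum_sqr_tail _ r01 _ _ C20 rate2 _ k (leq_trans m2 mn)) _.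
  have s1 : 1 <= rsum r n by apply: le_trans sm (le_rsum _ r01 _ _ mn).
  have e3 := rate3 n (leq_trans m3 mn).
  apply: le_trans (_ : _ <= 2 * C2 * (3 * rsum r n * (C3 * cprod r n))) _; last by rewrite /Ct; lra.
  rewrite ler_wpM2l ?mulr_ge0 ?(ltW C20)// ler_pM ?expR_ge0//; first by lra.
  by lra.
have rate n : (m <= n)%N -> r n <= C1 * (cprod r n.+1 * rsum r n.+1).
  by move=> mn; apply: rate1; exact: leq_trans mn.
apply/le_anti/andP; split; last by apply: mean_ge0 => w; rewrite indicE.
apply/ler_addgt0Pl => eps eps0; rewrite addr0.
have eps20 : 0 < eps / 2 by lra.
(* Then [exp (- (K / Ct / 4))] is at most [eps / 2]. *)
pose K := Ct * (4 * (`|ln (eps / 2)| + 1)).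
have K0 : 0 < K by rewrite !mulr_gt0// ltr_wpDl.
have [j Hj] := mean_stay_small P r F M D r01 HU A e C1 K m FA (fun w => id) e0 C10 K0 rate sm _ Sinf eps20.
have := mean_limit0_le_stay P r F M D r01 HU A K m FA sm Zinf Ct j mZ cv Ct0 tail.
move/le_trans; apply; rewrite [leRHS]splitr lerD//.
rewrite -[leRHS]lnK ?posrE// ler_expR.
have -> : K / Ct / 4 = `|ln (eps / 2)| + 1 by rewrite /K; field; rewrite gt_eqF.
have := ler_norm (- ln (eps / 2)); rewrite normrN; lra.
Qed.

(** The event of a positive start is the countable union of the events [M 0 >= 1 / (k + 1)]. *)
Lemma urn_limit_neq0 (Zinf : T -> R) :
  rate_exp r -> (forall B : R, exists n, B <= rsum r n) ->
  measurable_fun setT Zinf ->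
  {ae P, forall w, M k w @[k --> \oo] --> Zinf w} ->
  P.-negligible ([set w | 0 < M 0%N w] `&` [set w | Zinf w = 0]).
Proof.
move=> re Sinf mZ cv; set B := [set w | Zinf w = 0].
have mB : measurable B.
  rewrite (_ : B = Zinf @^-1` [set 0])//.
  by rewrite -[X in measurable X]setTI; exact: mZ.
have mM : measurable_fun setT (M 0%N) by case: ((bounded_mfunP _).1 (bmf_M _ _ _ _ _ HU 0%N)).
pose A k := [set w | k.+1%:R^-1 <= M 0%N w].
have mA k : measurable (A k).
  rewrite (_ : A k = M 0%N @^-1` `[k.+1%:R^-1, +oo[).
    by rewrite -[X in measurable X]setTI; exact: mM.
  by apply/seteqP; split => w /=; rewrite in_itv/= andbT.
apply: (@negligibleS _ _ _ _ (\bigcup_k (A k `&` B))).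
  move=> w [/= M0 Bw]; exists (Num.truncn (M 0%N w)^-1) => //; split => //=.
  by rewrite /A/= invf_ple ?posrE// ltW// truncnS_gt.
apply: negligible_bigcup => k; apply/negligibleP; first exact: measurableI.
have k0 : (0 : R) < k.+1%:R^-1 by rewrite invr_gt0.
apply: etrans (esym (mean_indic P _ _)) _; first exact: measurableI.
by rewrite (urn_limit_neq0_ge _ _ re Sinf mZ cv k0).
Qed.

End UrnNonExtinction.

(** * The network *)

Section Perron.
Context {R : realType} {N : nat} (W : 'M[R]_N).
Hypothesis HW : column_stochastic W.
Hypothesis irrW : irreducible_mx W.
Hypothesis N0 : (0 < N)%N.

(* [W - 1] is singular because its columns sum to 0, and the entrywise
   absolute value of a fixed vector is again fixed. *)
Lemma perron_vector : exists v : 'I_N -> R,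
  [/\ forall l, 0 < v l, \sum_l v l = 1 &
      forall l1, \sum_l W l1 l * v l = v l1].
Proof.
have [W0 W1] := HW.
have /det0P [u u0 Hu] : \det (W - 1%:M)^T == 0.
  rewrite det_tr; apply/det0P; exists (const_mx 1).
    apply/negP => /eqP /matrixP /(_ 0 (Ordinal N0)); rewrite !mxE.
    by move/eqP; rewrite oner_eq0.
  apply/matrixP => i j; rewrite !mxE.
  under eq_bigr do rewrite !mxE mul1r.
  by rewrite sumrB W1 (bigD1 j)//= eqxx big1 ?addr0 ?subrr// => k /negbTE ->.
have uW i : \sum_j W i j * u 0 j = u 0 i.
  move/matrixP: Hu => /(_ 0 i); rewrite !mxE.
  under eq_bigr do rewrite !mxE mulrBr.
  rewrite sumrB => /eqP; rewrite subr_eq0 => /eqP h.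
  transitivity (\sum_j u 0 j * W i j); first by apply: eq_bigr => j _; rewrite mulrC.
  rewrite h (bigD1 i)//= eqxx mulr1 big1 ?addr0// => k.
  by rewrite eq_sym => /negbTE ->; rewrite mulr0.
pose a i := `|u 0 i|.
have aW i : \sum_j W i j * a j = a i.
  (* The triangle inequality makes every defect nonnegative, and the unit column sums make the
     defects add up to 0. *)
  have ge k : 0 <= \sum_j W k j * a j - a k.
    rewrite subr_ge0 /a -[in leLHS]uW; apply: le_trans (ler_norm_sum _ _ _) _.
    by apply: ler_sum => j _; rewrite normrM (ger0_norm (W0 _ _)).
  have s0 : \sum_k (\sum_j W k j * a j - a k) = 0.
    rewrite sumrB exchange_big/= -sumrB big1// => j _.
    by rewrite -mulr_suml W1 mul1r subrr.
  have /eqP := @psumr_eq0P _ _ xpredT _ (fun k _ => ge k) s0 i isT.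
  by rewrite subr_eq0 => /eqP.
have WnE n : (forall i j, 0 <= (W ^+ n) i j) /\ forall i, \sum_j (W ^+ n) i j * a j = a i.
  elim: n => [|n [IH0 IH1]].
    rewrite expr0; split=> i; first by move=> j; rewrite !mxE; case: eqP.
    rewrite (bigD1 i)//= big1 ?addr0 ?mxE ?eqxx ?mul1r// => k.
    by rewrite !mxE eq_sym => /negbTE ->; rewrite mul0r.
  rewrite exprS; split=> i.
    by move=> j; rewrite !mxE; apply: sumr_ge0 => k _; rewrite mulr_ge0.
  under eq_bigr do rewrite !mxE mulr_suml.
  rewrite exchange_big/= -[RHS]aW; apply: eq_bigr => k _.
  by rewrite -IH1 mulr_sumr; apply: eq_bigr => j _; rewrite mulrA.
have [k ak] : exists k, 0 < a k.
  apply: contrapT => H; move/eqP: u0; apply; apply/rowP => k; rewrite mxE.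
  apply/eqP; rewrite -normr_le0 leNgt; apply/negP => h; apply: H; by exists k.
(* Irreducibility carries positivity from [k] to [i] through a power of [W] that also fixes [a]. *)
have a0 i : 0 < a i.
  have [n _ Wn] := irrW i k; have [Wn0 Wn1] := WnE n.
  rewrite -Wn1 (bigD1 k)//= ltr_pwDl ?mulr_gt0//.
  by apply: sumr_ge0 => j _; rewrite mulr_ge0// /a.
have s0 : 0 < \sum_l a l.
  by rewrite (bigD1 k)//= ltr_pwDl// sumr_ge0// => j _; exact: ltW.
exists (fun l => a l / \sum_l a l); split.
- by move=> l; rewrite divr_gt0.
- by rewrite -mulr_suml divff// gt_eqF.
- move=> l1; under eq_bigr do rewrite mulrA.
  by rewrite -mulr_suml aW.
Qed.

End Perron.

Section UrnComplement.
Context {R : realType} {d : measure_display} {T : measurableType d}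
  (P : probability T R).
Context (r : nat -> R) (F : nat -> set (set T)) (M D : nat -> T -> R).
Hypothesis HU : is_urn P r F M D.

(** This symmetry turns convergence to 1 into convergence to 0. *)
Lemma is_urn_compl : is_urn P r F (fun n w => 1 - M n w) (fun n w => 1 - D n w).
Proof.
case: (HU) => s mo M01 D01 ad bD st me; split => //.
- by move=> n w; have /andP[] := M01 n w; move=> *; apply/andP; split; lra.
- by move=> n w; have /andP[] := D01 n w; move=> *; apply/andP; split; lra.
- by move=> n; apply: bounded_mfunB => //; exact: bounded_mfun_cst.
- by move=> n; apply: bounded_mfunB; [exact: bounded_mfun_cst|exact: bD].
- by move=> n w; rewrite st; ring.
- move=> n A FA; rewrite (@eq_mean _ _ _ P _ (fun w => - 1 * ((D n w - M n w) * \1_A w))).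
    rewrite meanZ ?me ?mulr0//; apply: bounded_mfunM.
      by apply: bounded_mfunB; [exact: bD|exact: bmf_M HU _].
    by apply: bmf_indic; exact: s FA.
  by move=> w; ring.
Qed.

End UrnComplement.

(** * The Perron-weighted network as a scalar martingale *)

Section NetworkUrn.
Context {R : realType} {d : measure_display} {Omega : measurableType d}
  {P : probability Omega R} {N : nat}.
Context (W : 'M[R]_N) (r : nat -> R) (X Z : nat -> 'I_N -> {RV P >-> R}).
Hypothesis r01 : forall n, 0 <= r n < 1.
Hypothesis net : is_reinforced_network W r X Z.
Context (v : 'I_N -> R).
Hypothesis v0 : forall l, 0 < v l.
Hypothesis v1 : \sum_l v l = 1.
Hypothesis vW : forall l1, \sum_l W l1 l * v l = v l1.

(** The generating family of [network_filtration], left unclosed because [is_urn] takes the closure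
    itself. *)
Definition network_generator n : set (set Omega) :=
  (\bigcup_l g_sigma_algebra_preimage (Z 0%N l)) `|`
  (\bigcup_(k in [set k : nat | (1 <= k <= n)%N])
     \bigcup_l g_sigma_algebra_preimage (X k l)).

Lemma network_Z01 n l w : 0 <= Z n l w <= 1.
Proof.
elim: n => [|n IH]; first exact: network_Z0 net _ _.
rewrite (network_step net); have /andP[r0 r1] := r01 n; have /andP[z0 z1] := IH.
have x01 : 0 <= X n.+1 l w <= 1.
  by case: (network_X01 net n l w) => ->; rewrite ?lexx ler01.
have /andP[x0 x1] := x01; apply/andP; split; nra.
Qed.

Let bmf_RV (Y : {RV P >-> R}) : (forall w, 0 <= Y w <= 1) -> bmf Y.
Proof.
move=> Y01; apply/bounded_mfunP; split; first exact: measurable_funPT.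
by exists 1 => w; have /andP[Y0 Y1] := Y01 w; rewrite ger0_norm.
Qed.

Let wmean_01 (y : 'I_N -> R) : (forall l, 0 <= y l <= 1) -> 0 <= \sum_l v l * y l <= 1.
Proof.
move=> y01; rewrite sumr_ge0//=; last first.
  by move=> l _; rewrite mulr_ge0 ?(ltW (v0 l))//; case/andP: (y01 l).
rewrite -v1; apply: ler_sum => l _; rewrite ler_piMr ?(ltW (v0 l))//.
by case/andP: (y01 l).
Qed.

(** The conditional mean of the weighted draws is [\sum_l v l * g n l], which equals the weighted
    [Z n] since [W] fixes [v]. *)
Lemma network_is_urn : is_urn P r network_generator
  (fun n w => \sum_l v l * Z n l w) (fun n w => \sum_l v l * X n.+1 l w).
Proof.
have X01 n l w : 0 <= X n.+1 l w <= 1.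
  by case: (network_X01 net n l w) => ->; rewrite ?lexx ler01.
have sub n : <<s network_generator n >> `<=` measurable.
  apply: smallest_sub; first exact: sigma_algebra_measurable.
  by move=> A [[l _]|[k _ [l _]]] [B mB <-]; apply: measurable_funPT.
pose g n l w := \sum_l1 W l1 l * Z n l1 w.
have gE n w : \sum_l v l * Z n l w = \sum_l v l * g n l w.
  rewrite /g; under [RHS]eq_bigr do rewrite mulr_sumr.
  rewrite exchange_big/=; apply: eq_bigr => l1 _.
  rewrite -[in LHS]vW mulr_suml; apply: eq_bigr => l _; ring.
have g01 n l w : 0 <= g n l w <= 1.
  have [W0 W1] := network_W net.
  rewrite /g sumr_ge0/=; last first.
    by move=> l1 _; rewrite mulr_ge0//; case/andP: (network_Z01 n l1 w).
  rewrite -(W1 l); apply: ler_sum => l1 _; rewrite ler_piMr//.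
  by case/andP: (network_Z01 n l1 w).
have gF n l : bounded_mfun (network_generator n) (g n l).
  split; last by exists 1 => w; have /andP[? ?] := g01 n l w; rewrite ger0_norm.
  move=> _ B mB; rewrite setTI; have [H _ _] := network_cond_prob net n l.
  exact: H.
have bg n l : bmf (g n l).
  by apply: bounded_mfun_sub (gF n l) => A /sub; exact: sub_sigma_algebra.
have bX n l : bmf (X n.+1 l) by apply: bmf_RV.
split => //.
- move=> n; apply: sub_sigma_algebra2 => A [H|[k /andP[k1 kn] H]]; first by left.
  by right; exists k => //=; rewrite k1 leqW.
- by move=> n w; apply: wmean_01 => l; exact: network_Z01.
- by move=> n w; exact: wmean_01.
(* Adaptedness is read off [g n l], measurable for the filtration as a version of a conditional
   probability. *)
- move=> n; rewrite (_ : (fun w => _) = (fun w => \sum_l v l * g n l w)).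
    apply: bounded_mfun_sum => l.
    by apply: bounded_mfunM; [exact: bounded_mfun_cst|exact: gF].
  by apply/funext => w; exact: gE.
- move=> n; apply: bounded_mfun_sum => l; apply: bounded_mfunM; last exact: bX.
  exact: bounded_mfun_cst.
- move=> n w; rewrite !mulr_sumr -big_split/=; apply: eq_bigr => l _.
  by rewrite (network_step net); ring.
move=> n A FA; have mA := sub n _ FA.
have bA : bmf (\1_A : Omega -> R) by exact: bmf_indic.
(* A variable with values 0 and 1 is the indicator of the event that it equals 1. *)
have Hl l : mean P (fun w => X n.+1 l w * \1_A w) = mean P (fun w => g n l w * \1_A w).
  have [_ _ H] := network_cond_prob net n l.
  have mX : measurable (X n.+1 l @^-1` [set 1]).
    by rewrite -[X in measurable X]setTI; apply: measurable_funPT.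
  have -> : mean P (fun w => g n l w * \1_A w) = Rintegral P A (g n l).
    by rewrite Rintegral_mkcond; apply: eq_mean => w; rewrite patch_indic.
  rewrite /Rintegral (H A FA) -mean_indic; last exact: measurableI.
  apply: eq_mean => w; rewrite !indicE in_setI mulrC -mulnb natrM mulrC.
  congr (_ * _); case: (network_X01 net n l w) => E; rewrite E.
    by rewrite memNset//= E => /esym/eqP; rewrite oner_eq0.
  by rewrite mem_set.
have bXA l : bmf (fun w => X n.+1 l w * \1_A w) by exact: bounded_mfunM _ _ _ (bX n l) bA.
have bgA l : bmf (fun w => g n l w * \1_A w) by exact: bounded_mfunM _ _ _ (bg n l) bA.
rewrite (@eq_mean _ _ _ P _ (fun w => \sum_l v l * (X n.+1 l w * \1_A w - g n l w * \1_A w))).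
  rewrite mean_sum; last first.
    move=> l; apply: bounded_mfunM; first exact: bounded_mfun_cst.
    exact: bounded_mfunB _ _ _ (bXA l) (bgA l).
  rewrite big1// => l _; rewrite meanZ; last exact: bounded_mfunB _ _ _ (bXA l) (bgA l).
  by rewrite meanB// Hl subrr mulr0.
move=> w; rewrite gE -sumrB mulr_suml; apply: eq_bigr => l _; ring.
Qed.

End NetworkUrn.

(** Both series in the synchronization condition have terms between 0 and [r n], so each would
    converge if [rsum] were bounded. *)
Lemma sync_condition_rsum (R : realType) (r : nat -> R) (N : nat) (W : 'M[R]_N) :
  (forall n, 0 <= r n < 1) -> sync_condition W r ->
  forall B : R, exists n, B <= rsum r n.
Proof.
move=> r01 sync B; apply: contrapT => nB.
have rB n : rsum r n <= B.
  by rewrite leNgt; apply/negP => h; apply: nB; exists n; exact: ltW.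
have bounded (a : nat -> R) : (forall n, 0 <= a n <= r n) ->
    (\sum_(n <oo) (a n)%:E <> +oo)%E.
  move=> ar; apply/eqP; rewrite lt_eqF//; apply: le_lt_trans (ltry B); apply: lime_le.
    by apply: is_cvg_nneseries => n _ _; rewrite lee_fin; case/andP: (ar n).
  apply: nearW => n; rewrite sumEFin lee_fin; apply: le_trans (rB n).
  by rewrite big_mkord; apply: ler_sum => i _; case/andP: (ar i).
case: sync => [[E _]|E].
  by apply: (bounded r _ E) => n; rewrite lexx andbT; case/andP: (r01 n).
apply: (bounded (fun n => r n * (1 - r n)) _ E) => n.
have /andP[r0 r1] := r01 n.
by rewrite mulr_ge0 ?subr_ge0 ?(ltW r1)//= ler_piMr// gerBl.
Qed.

Theorem theorem3p1 (R : realType) (r : nat -> R)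
    (r01 : forall n, 0 <= r n < 1) :
  [/\ rate_exp r <-> rate_prod r,
      forall (d : measure_display) (Omega : measurableType d)
          (P : probability Omega R) (N : nat) (W : 'M[R]_N)
          (X Z : nat -> 'I_N -> {RV P >-> R}) (Zinf : {RV P >-> R}),
        (2 <= N)%N ->
        is_reinforced_network W r X Z ->
        irreducible_mx W ->
        (P (T0 Z) < 1)%E ->
        sync_condition W r ->
        is_common_as_limit Z Zinf ->
        rate_exp r \/ rate_prod r ->
        cond_prob_event P (Tinf Zinf) (~` T0 Z) = 0
    & forall c : R, 0 < c <= 1 ->
        n%:R * r n @[n --> \oo] --> c ->
        cvgn (fun m => \sum_(1 <= n < m) (r n - c * n%:R^-1)) ->
        rate_exp r /\ rate_prod r ].
Proof.
have rates := rate_exp_prod r r01.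
split => //; last first.
  move=> c c01 nr cv; have re := rate_exp_near_harmonic r r01 c c01 nr cv.
  by split => //; exact/rates.
move=> d Omega P N W X Z Zinf N2 net irrW _ sync lim rate.
have re : rate_exp r by case: rate => // /rates.
have Sinf := sync_condition_rsum R r N W r01 sync.
have [v [v0 v1 vW]] := perron_vector W (network_W net) irrW (ltnW N2).
have urn := network_is_urn W r X Z r01 net v v0 v1 vW.
have limM : {ae P, forall w, (\sum_l v l * Z n l w) @[n --> \oo] --> Zinf w}.
  have : {ae P, forall w, forall l, Z n l w @[n --> \oo] --> Zinf w} by exact: filter_forall.
  apply: filterS => w Hw.
  rewrite -[X in _ --> X]mul1r -v1 mulr_suml.
  by apply: (cvg_big (op := +%R)) => [|l _]; [exact: add_continuous|apply: cvgMr].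
have limM' : {ae P, forall w, (1 - \sum_l v l * Z n l w) @[n --> \oo] --> 1 - Zinf w}.
  by apply: filterS limM => w Hw; apply: cvgB => //; exact: cvg_cst.
have mZ : measurable_fun setT Zinf by exact: measurable_funPT.
have mZ' : measurable_fun setT (fun w => 1 - Zinf w).
  by apply: measurable_funB => //; exact: measurable_cst.
have n0 := urn_limit_neq0 P r _ _ _ r01 urn _ re Sinf mZ limM.
have n1 := urn_limit_neq0 P r _ _ _ r01 (is_urn_compl _ _ _ _ _ urn) _ re Sinf mZ' limM'.
have pos (y : 'I_N -> R) : (forall l, 0 <= y l) -> ~ (forall l, y l = 0) ->
    0 < \sum_l v l * y l.
  move=> y0 /existsNP[l /eqP yl]; rewrite (bigD1 l)//= ltr_pwDl//.
    by rewrite mulr_gt0// lt_neqAle eq_sym yl y0.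
  by apply: sumr_ge0 => k _; rewrite mulr_ge0// ltW.
(* Outside [T0] some [Z 0 l] is positive and some is below 1; as all weights are positive, both the
   weighted mean and its complement start positive. *)
have neg : P.-negligible (Tinf Zinf `&` ~` T0 Z).
  apply: negligibleS (negligibleU n0 n1) => w [[Zw|Zw] /not_orP[nZ0 nZ1]].
    left; split => //=; apply: pos => // l.
    by case/andP: (network_Z0 net l w).
  right; split => /=; last by rewrite Zw subrr.
  rewrite -v1 -sumrB; under eq_bigr do rewrite -{1}[v _]mulr1 -mulrBr.
  apply: pos => [l|H]; first by rewrite subr_ge0; case/andP: (network_Z0 net l w).
  by apply: nZ1 => l; apply/eqP; rewrite eq_sym -subr_eq0; apply/eqP.
have meas1 (Y : {RV P >-> R}) (c : R) : measurable [set w | Y w = c].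
  have := @measurable_funPT _ _ _ _ Y measurableT [set c] (measurable_set1 c).
  by rewrite setTI.
have mT : measurable (Tinf Zinf `&` ~` T0 Z).
  apply: measurableI; first exact: measurableU.
  have mc (c : R) : measurable [set w | forall l, Z 0%N l w = c].
    rewrite (_ : [set w | _] = \bigcap_l [set w | Z 0%N l w = c]); last first.
      by apply/seteqP; split => w /= H l; [move=> _; exact: H|exact: H].
    exact: fin_bigcap_measurable.
  by apply: measurableC; apply: measurableU.
rewrite /cond_prob_event.
have /= -> := measure_negligible mT neg.
by rewrite mul0r.
Qed.
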